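(* Fix the norm $\|\cdot\|=\ell_r$ on $\mathbb{R}^n$ with $r\in\{1,2,\infty\}$ (write $n^{1/\infty}=1$), and let $n\ge2$. Let $a\ge b$ be positive integers, $\alpha=a/b$, and $M\in\mathrm{M}_n(\mathbb{Z})$ with $\det M\ne0$ and $M_{n,1}=\max_{i,j}|M_{i,j}|$. Run the following algorithm: (1) $p\leftarrow$ least prime not dividing $M_{n,1}\det M$; (2) $M(x)\leftarrow x\,\mathrm{adj}\,M+p\,\mathrm{Id}$ (entries in $\mathbb{Z}[x]$); (3) for $i=2,\dots,n$: add $p$ to the $(i,1)$ entry of $M(x)$; then add $p^{j}$ to the $(i,i-1)$ entry, with $j>0$ minimal such that $\det C\big((\mathrm{adj}\,\check M(x)_i)_{i,1},(\mathrm{adj}\,\check M(x)_i)_{i,2}\big)\ne0$ for the resulting matrix; (4) $c\leftarrow\det C\big((\mathrm{adj}\,M(x))_{n,1},(\mathrm{adj}\,M(x))_{n,2}\big)$; if $|c|$ is a power of $p$ set $c\leftarrow p+1$, otherwise $c\leftarrow c/p^k$ with $p^k$ the largest power of $p$ dividing $c$; (5) $M'\leftarrow M(c^{j})\in\mathrm{M}_n(\mathbb{Z})$ with $j=\lceil\log_{|c|}a^2(2M_{n,1}n)^{3n}\rceil$ (here $M_{n,1}$ is the input entry); (6) $b_1,b_2\leftarrow$ integers with $|b_1|$ minimal such that $1=b_1(\mathrm{adj}\,M')_{n,1}+b_2(\mathrm{adj}\,M')_{n,2}$; (7) $\mathbf{x}\leftarrow M'^{-1}(b_1,b_2,0,\dots,0)^T$;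 (8) $q_0\leftarrow$ either any valid output of the simultaneous approximation problem with input $(\alpha,\mathbf{x})$, or any valid output of the good Diophantine approximation problem with input $(\alpha/n^{1/r},\mathbf{x},N)$ where $N=n^{1/r}\det M'/(2\alpha)$; (9) return $\mathbf{q}_0=M'\{q_0\mathbf{x}\}$. Then $\mathbf{q}_0\in\mathbb{Z}^n$ is a valid output of the short vector problem with input $(\alpha,M)$, i.e. $0<\|M\mathbf{q}_0\|\le\alpha\min^\times_{\mathbf{q}\in\mathbb{Z}^n}\|M\mathbf{q}\|$.
   Context: For a square matrix $B$ (entries possibly polynomials), $\mathrm{adj}\,B$ is its adjugate, $B_{i,j}$ its $(i,j)$ entry, and $\check{B}_i$ its top-left $i\times i$ submatrix. For $f_1=\sum_i f_{1,i}x^i$, $f_2=\sum_i f_{2,i}x^i$ in $\mathbb{Z}[x]$ with $D=\max(\deg f_1,\deg f_2)$, $C(f_1,f_2)$ is the $2D\times 2D$ matrix whose $(r',j)$ entry ($1\le j\le D$) is $f_{1,D-(r'-j)}$ if $0\le r'-j\le D$ and $0$ otherwise, and whose $(r',D+j)$ entry is $f_{2,D-(r'-j)}$ if $0\le r'-j\le D$ and $0$ otherwise. $M(c^j)$ means substituting $c^j$ for $x$. For $\mathbf{y}\in\mathbb{R}^n$, $\{\mathbf{y}\}\in(-1/2,1/2]^n$ is the coordinatewise fractional part; $[t]=\{1,\dots,\lfloor t\rfloor\}$; $\min^\times$ is the minimum over nonzero values. All problems use the same norm $\|\cdot\|$. Short vector problem on $(\alpha,M)$: valid outputs are $\mathbf{q}_0\in\mathbb{Z}^n$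 with $0<\|M\mathbf{q}_0\|\le\alpha\min^\times_{\mathbf{q}\in\mathbb{Z}^n}\|M\mathbf{q}\|$. Simultaneous approximation problem on $(\beta,\mathbf{x})$: valid outputs are $q_0\in\mathbb{Z}$ with $0<\|\{q_0\mathbf{x}\}\|\le\beta\min^\times_{q\in\mathbb{Z}}\|\{q\mathbf{x}\}\|$. Good Diophantine approximation problem on $(\beta,\mathbf{x},N)$: valid outputs are $q_0\in[\beta N]$ with $\|\{q_0\mathbf{x}\}\|\le\beta\min_{q\in[N]}\|\{q\mathbf{x}\}\|$. *)

(* Defs.v *)
From HB Require Import structures.
From mathcomp Require Import all_boot all_order all_algebra.
From mathcomp Require Import all_classical all_reals all_analysis.

Set Implicit Arguments.
Unset Strict Implicit.
Unset Printing Implicit Defensive.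

Import Order.TTheory GRing.Theory Num.Theory.
Local Open Scope classical_set_scope.
Local Open Scope ring_scope.

Definition is_least (P : nat -> Prop) (k : nat) : Prop :=
  P k /\ forall l, P l -> (k <= l)%N.

Section Problems.
Variable R : realType.

Definition is_minimum (S : set R) (m : R) : Prop := S m /\ lbound S m.

(* The values r < 1 and r = -oo are never used. *)
Definition lnorm (r : \bar R) (n : nat) (v : 'cV[R]_n) : R :=
  match r with
  | EFin s => (\sum_i `|v i 0| `^ s) `^ s^-1
  | EPInf => \big[Num.max/0]_i `|v i 0|
  | ENInf => 0
  end.

(* n^(1/r), with n^(1/oo) = 1 *)
Definition root_dim (r : \bar R) (n : nat) : R :=
  match r with
  | EFin s => n%:R `^ s^-1
  | _ => 1
  end.

(* The representative of y modulo 1 in (-1/2, 1/2]. *)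
Definition cfrac (y : R) : R := y - (Num.ceil (y - 2^-1))%:~R.

Definition cfracv (n : nat) (y : 'cV[R]_n) : 'cV[R]_n := map_mx cfrac y.

Definition bracket (t : R) : set int := [set q | 1 <= q <= Num.floor t].

Definition short_vector (r : \bar R) (n : nat) (alpha : R) (M : 'M[R]_n)
    (q0 : 'cV[int]_n) : Prop :=
  let len (q : 'cV[int]_n) := lnorm r (M *m map_mx intr q) in
  exists2 mu, is_minimum (range len `\ 0) mu
            & 0 < len q0 <= alpha * mu.

Definition simultaneous_approx (r : \bar R) (n : nat) (beta : R)
    (x : 'cV[R]_n) (q0 : int) : Prop :=
  let dist (q : int) := lnorm r (cfracv (q%:~R *: x)) in
  exists2 mu, is_minimum (range dist `\ 0) mu
            & 0 < dist q0 <= beta * mu.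

Definition good_diophantine_approx (r : \bar R) (n : nat) (beta : R)
    (x : 'cV[R]_n) (N : R) (q0 : int) : Prop :=
  let dist (q : int) := lnorm r (cfracv (q%:~R *: x)) in
  bracket (beta * N) q0 /\
  exists2 mu, is_minimum (dist @` bracket N) mu
            & dist q0 <= beta * mu.

End Problems.

Section Algorithm.

Definition maxdeg (f1 f2 : {poly int}) : nat :=
  maxn (size f1).-1 (size f2).-1.

Definition shift_block (D : nat) (f : {poly int}) : 'M[int]_(D + D, D) :=
  \matrix_(i, j)
    if (j <= i)%N && (i - j <= D)%N then f`_(D - (i - j)) else 0.

(* Not the Sylvester matrix of the library: the shape depends only on the
   maximum of the two degrees. *)
Definition Cmx (f1 f2 : {poly int}) :
    'M[int]_(maxdeg f1 f2 + maxdeg f1 f2) :=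
  row_mx (shift_block (maxdeg f1 f2) f1) (shift_block (maxdeg f1 f2) f2).

Definition detC_adj (n : nat) (B : 'M[{poly int}]_n.+2) : int :=
  \det (Cmx (\adj B ord_max 0) (\adj B ord_max 1)).

(* Top-left submatrix, for k <= n.+2 only. *)
Definition topleft (n k : nat) (B : 'M[{poly int}]_n.+2) :
    'M[{poly int}]_k :=
  \matrix_(i, j) B (inord i) (inord j).

Definition init_mx (n : nat) (M : 'M[int]_n.+2) (p : nat) :
    'M[{poly int}]_n.+2 :=
  'X *: map_mx polyC (\adj M) + (p%:R)%:M.

(* Round k = 0, ..., n of the loop treats the row with 1-based index k + 2:
   p is added to its first entry and p ^ e to the one left of the diagonal
   (these coincide when k = 0). *)
Definition perturb (n : nat) (p k e : nat) (B : 'M[{poly int}]_n.+2) :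
    'M[{poly int}]_n.+2 :=
  B + p%:R *: delta_mx (inord k.+1) 0
    + (p%:R ^+ e) *: delta_mx (inord k.+1) (inord k).

(* The matrix after k rounds, e i being the exponent chosen in round i. *)
Fixpoint loop_mx (n : nat) (M : 'M[int]_n.+2) (p : nat) (e : nat -> nat)
    (k : nat) : 'M[{poly int}]_n.+2 :=
  if k is k'.+1 then perturb p k' (e k') (loop_mx M p e k')
  else init_mx M p.

(* p ^ 0 = 1 counts as a power of p. *)
Definition reduced_c (p : nat) (c0 c : int) : Prop :=
  ((exists k, `|c0|%N = p ^ k)%N /\ c = p.+1%:Z) \/
  (~ (exists k, `|c0|%N = p ^ k)%N /\
   exists k : nat, [/\ ((p ^ k)%N%:Z %| c0)%Z,
                      ~~ ((p ^ k.+1)%N%:Z %| c0)%Z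
                    & c = (c0 %/ (p ^ k)%N%:Z)%Z]).

(* The real whose logarithm in base |c| determines the substituted power. *)
Definition size_bound (R : realType) (n : nat) (a : nat) (M : 'M[int]_n.+2) : R :=
  a%:R ^+ 2 * (2 * (M ord_max 0)%:~R * n.+2%:R) ^+ (3 * n.+2).

Definition min_bezout (A B b1 b2 : int) : Prop :=
  1 = b1 * A + b2 * B /\
  forall b1' b2' : int, 1 = b1' * A + b2' * B -> `|b1| <= `|b1'|.

(* The values computed by an execution, up to and including the choice of
   b1 and b2; [run_unit] says that the inverse of M' used next exists. *)
Record run (R : realType) (n : nat) (a : nat) (M : 'M[int]_n.+2)
    (p : nat) (e : nat -> nat) (c : int) (j : nat) (M' : 'M[int]_n.+2)
    (b1 b2 : int) : Prop := Run {
  run_p : is_least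
    (fun q => prime q /\ ~~ (q%:Z %| (M ord_max 0 * \det M)%R)%Z) p;
  run_loop : forall k, (k <= n)%N -> is_least
    (fun i => (0 < i)%N /\
       detC_adj (topleft k.+2 (perturb p k i (loop_mx M p e k))) != 0) (e k);
  run_c : reduced_c p (detC_adj (loop_mx M p e n.+1)) c;
  run_j : j%:Z = Num.ceil (ln (size_bound R a M) / ln (`|c|%:~R : R));
  run_M' : M' = map_mx (fun f : {poly int} => f.[c ^+ j]) (loop_mx M p e n.+1);
  run_b : min_bezout (\adj M' ord_max 0) (\adj M' ord_max 1) b1 b2;
  run_unit : \det M' != 0
}.

Definition target_vec (R : realType) (n : nat) (M' : 'M[int]_n.+2)
    (b1 b2 : int) : 'cV[R]_n.+2 :=
  invmx (map_mx intr M') *m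
  \col_i (if i == 0 then b1%:~R else if i == 1 then b2%:~R else 0).

End Algorithm.

(* Main.v *)
(* Write m for the dimension, X for the largest entry of M and P for the lower
   triangular matrix of powers of p added to x adj M, so that M' = c^j adj M + P
   and M M' = K + M P with K = c^j det M.

   Correctness.  The integers b1, b2 complete the first m - 1 columns of M' to
   a unimodular matrix, so x generates M'^-1 Z^m modulo Z^m: every integer
   vector v is M' y with y congruent to a multiple of x.  As M v = (K + M P) y
   and M P is tiny compared with K, the map v -> y is almost a similarity and
   best approximations correspond to shortest vectors up to a factor 1 + eps.
   Some power 1 or 2 of the norm is integral on Z^m, so this factor is harmless.
   The last coordinate of x is 1 / det M', which confines the relevant
   multipliers to [N] in the Diophantine variant.

   Termination and sizes.  In the round treating row s, adding t to the entry
   left of the diagonal changes the two cofactors g1, g2 into g1 + t h1 and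
   g2 + t h2, where h1, h2 are those of the previous round.  A common root is a
   root of g1 h2 - g2 h1, which has degree at most 2 s - 3 and does not vanish
   at 0, and it determines t; hence the exponent is at most 2 s - 2.  All primes
   below p divide X det M, so a Chebyshev bound for their product shows that
   p^(2 m - 2) is small enough.

   Coprimality.  A prime dividing both cofactors at x = c^j divides det C.  If it
   is not p it divides c, hence the value p^k of the second cofactor at 0;
   modulo p, adj M' is a nonzero multiple of M. *)
Require Import Defs.
From HB Require Import structures.
From mathcomp Require Import all_boot all_order all_algebra all_field.
From mathcomp Require Import all_classical all_reals all_analysis.
From mathcomp Require Import zify ring lra.

Import Order.TTheory GRing.Theory Num.Theory.
Local Open Scope classical_set_scope.
Local Open Scope ring_scope.

Set Implicit Arguments.
Unset Strict Implicit.
Unset Printing Implicit Defensive.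

(** * Resultants with the matrix C *)

(** Row [i] carries the monomial of degree 2D - 1 - i. Since D - (i - j) + (D - 1 - j) = 2D - 1 - i,
    column [j] then encodes [f] shifted by D - 1 - j. *)
Lemma shift_blockE (D : nat) (f : {poly int}) (j : 'I_D) :
  (size f <= D.+1)%N ->
  \sum_(i < D + D) (shift_block D f i j)%:P * 'X^(D + D - i.+1) =
  f * 'X^(D - j.+1).
Proof.
move=> sf; apply/polyP => l; rewrite coef_sum coefMXn.
under eq_bigr => i _ do rewrite coefCM coefXn mxE.
have jD := ltn_ord j.
have [lD|Dl] := ltnP l (D + D).
  have iP : (D + D - l.+1 < D + D)%N by lia.
  rewrite (bigD1 (Ordinal iP)) //= big1 => [|i iN]; last first.
    case: eqP => [le|]; last by rewrite mulr0.
    case/negP: iN; apply/eqP/val_inj => /=; have := ltn_ord i; lia.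
  rewrite addr0 (_ : _ == _); last by apply/eqP; lia.
  rewrite mulr1; case: ltnP => h1; first by rewrite ifF //; lia.
  case: ifP => h2; first by congr (f`_ _); lia.
  by rewrite nth_default //; apply: leq_trans sf _; lia.
rewrite big1 => [|i _]; last by rewrite (_ : _ == _ = false) ?mulr0 //; have := ltn_ord i; lia.
rewrite ifF ?nth_default //; last lia; apply: leq_trans sf _; lia.
Qed.

Lemma size_maxdeg (f1 f2 : {poly int}) :
  (size f1 <= (maxdeg f1 f2).+1)%N /\ (size f2 <= (maxdeg f1 f2).+1)%N.
Proof. rewrite /maxdeg; split; lia. Qed.

(** The matrix C encodes the map (u, v) -> f1 u + f2 v on pairs of polynomials of degree below D.
    The ring is arbitrary because the Bezout identity needs [int] and the kernel argument needs
    [algC]. *)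
Lemma Cmx_combination (f1 f2 : {poly int}) (R : comNzRingType)
    (w : 'cV[R]_(maxdeg f1 f2 + maxdeg f1 f2)) :
  let D := maxdeg f1 f2 in
  let comb g := \sum_(j < D) (w (g j) 0)%:P * 'X^(D - j.+1) in
  \sum_(i < D + D) ((map_mx intr (Cmx f1 f2) *m w) i 0)%:P * 'X^(D + D - i.+1)
  = map_poly intr f1 * comb (@lshift D D) + map_poly intr f2 * comb (@rshift D D).
Proof.
move=> D comb; have [s1 s2] := size_maxdeg f1 f2.
have key (f : {poly int}) (g : 'I_D -> 'I_(D + D)) : (size f <= D.+1)%N ->
    \sum_(i < D + D) \sum_(j < D)
      ((shift_block D f i j)%:~R * w (g j) 0)%:P * 'X^(D + D - i.+1)
    = map_poly intr f * comb g.
  move=> sf; rewrite exchange_big /= /comb mulr_sumr; apply: eq_bigr => j _.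
  rewrite mulrCA (_ : 'X^(D - j.+1) = map_poly intr 'X^(D - j.+1)); last by rewrite map_polyXn.
  rewrite -rmorphM /= -shift_blockE // rmorph_sum mulr_sumr.
  apply: eq_bigr => i _; rewrite rmorphM /= map_polyXn map_polyC /= polyCM.
  by rewrite mulrA [X in X * _]mulrC.
rewrite -!key // -big_split /=; apply: eq_bigr => i _.
rewrite mxE big_split_ord /= polyCD mulrDl !rmorph_sum !mulr_suml.
by congr (_ + _); apply: eq_bigr => j _; rewrite mxE ?row_mxEl ?row_mxEr.
Qed.

Lemma detC_bezout (f1 f2 : {poly int}) : (0 < maxdeg f1 f2)%N ->
  exists u v, f1 * u + f2 * v = (\det (Cmx f1 f2))%:P.
Proof.
move=> D0; set D := maxdeg f1 f2 in D0 *.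
have lP : ((D + D).-1 < D + D)%N by lia.
pose l := Ordinal lP.
(* Since C adj C = det C, the last column of the adjugate is sent to det C times the last basis
   vector, which encodes a constant polynomial. *)
have := @Cmx_combination f1 f2 int (col l (\adj (Cmx f1 f2))).
have mapid (f : {poly int}) : map_poly intr f = f.
  by apply/polyP => i; rewrite coef_map_id0 //= intz.
rewrite /= !mapid (_ : map_mx _ _ = Cmx f1 f2); last first.
  by apply/matrixP => i j; rewrite mxE intz.
move=> E; do 2 eexists; apply: (etrans (esym E)).
rewrite (bigD1 l) //= big1 ?addr0 => [|i il]; last first.
  rewrite colE mulmxA mul_mx_adj mul_scalar_mx !mxE andbT (negbTE il).
  by rewrite mulr0 mul0r.
rewrite colE mulmxA mul_mx_adj mul_scalar_mx !mxE !eqxx mulr1.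
by rewrite (_ : (_ - _)%N = 0)%N ?mulr1 //; lia.
Qed.

(** A kernel vector of C over [algC] is a relation f1 u + f2 v = 0 with u, v of degree below D and
    not both zero. Without a common root, the polynomial of degree exactly D divides the multiplier
    of the other one by Gauss, although that multiplier has smaller degree. *)
Lemma detC_eq0_root (f1 f2 : {poly int}) : \det (Cmx f1 f2) = 0 ->
  exists z : algC, root (map_poly intr f1) z && root (map_poly intr f2) z.
Proof.
move=> d0; set D := maxdeg f1 f2.
(* An empty matrix has determinant 1. *)
have D0 : (0 < D)%N.
  move: d0; rewrite /D; move: (Cmx _ _); case: (maxdeg _ _) => // A.
  by rewrite det_mx00.
pose F1 := map_poly (intr : int -> algC) f1.
pose F2 := map_poly (intr : int -> algC) f2.
have [cop|] := boolP (coprimep F1 F2); last first.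
  rewrite coprimep_def => /closed_rootP [z]; rewrite root_gcd => ?; by exists z.
have : \det ((map_mx intr (Cmx f1 f2))^T : 'M[algC]_(D + D)) == 0.
  by rewrite det_tr det_map_mx d0.
case/det0P => w w0 /(congr1 trmx); rewrite trmx_mul trmxK trmx0 => Cw.
have := Cmx_combination w^T; rewrite -/D /= -/F1 -/F2.
rewrite big1 => [|i _]; last by rewrite Cw mxE polyC0 mul0r.
set u := \sum_j _; set v := \sum_j _ => uv.
have sz (g : 'I_D -> 'I_(D + D)) :
    (size (\sum_(j < D) (w^T (g j) 0)%:P * 'X^(D - j.+1))%R <= D)%N.
  apply: leq_trans (size_sum _ _ _) _; apply/bigmax_leqP => j _.
  rewrite mul_polyC; apply: leq_trans (size_scale_leq _ _) _.
  by rewrite size_polyXn; have := ltn_ord j; lia.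
have coef (g : 'I_D -> 'I_(D + D)) (i : 'I_D) :
   (\sum_(j < D) (w^T (g j) 0)%:P * 'X^(D - j.+1))%R`_(D - i.+1) = w 0 (g i).
  rewrite coef_sum (bigD1 i) //= coefCM coefXn eqxx mulr1 mxE big1 ?addr0 // => j ij.
  rewrite coefCM coefXn (_ : (_ == _) = false) ?mulr0 //.
  apply/negP => /eqP h; case/negP: ij; apply/eqP/val_inj => /=.
  by have := ltn_ord i; have := ltn_ord j; lia.
suff [u0 v0] : u = 0 /\ v = 0.
  case/negP: w0; apply/eqP/rowP => i; rewrite mxE -(fintype.splitK i).
  by case: (fintype.split i) => j /=; rewrite -coef -?/u -?/v ?u0 ?v0 coef0.
have sF (f : {poly int}) : size (map_poly (intr : int -> algC) f) = size f.
  by rewrite size_map_inj_poly //; exact: intr_inj.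
have [E|E] : size F1 = D.+1 \/ size F2 = D.+1.
- by rewrite !sF; move: D0; rewrite /D /maxdeg; lia.
- have v0 : v = 0.
    apply/eqP; apply: contraTT (sz (@rshift D D)) => v0; rewrite -ltnNge -/v -E.
    apply: dvdp_leq => //; rewrite -(Gauss_dvdpr _ cop).
    by move/esym/eqP: uv; rewrite addrC addr_eq0 => /eqP ->; rewrite dvdpNr dvdp_mulr.
  split=> //; move/esym/eqP: uv; rewrite v0 mulr0 addr0 mulf_eq0.
  by rewrite -size_poly_eq0 E => /eqP.
- have u0 : u = 0.
    apply/eqP; apply: contraTT (sz (@lshift D D)) => u0; rewrite -ltnNge -/u -E.
    apply: dvdp_leq => //; rewrite coprimep_sym in cop; rewrite -(Gauss_dvdpr _ cop).
    by move/esym/eqP: uv; rewrite addr_eq0 => /eqP ->; rewrite dvdpNr dvdp_mulr.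
  split=> //; move/esym/eqP: uv; rewrite u0 mulr0 add0r mulf_eq0.
  by rewrite -size_poly_eq0 E => /eqP.
Qed.

(** Roots in [algC] express coprimality over the rationals: common nonzero integer factors do not
    count. *)
Definition coprime_roots (f1 f2 : {poly int}) := forall z : algC,
  ~~ (root (map_poly intr f1) z && root (map_poly intr f2) z).

Lemma coprime_roots_sign (a b : nat) (f1 f2 : {poly int}) :
  coprime_roots ((-1) ^+ a * f1) ((-1) ^+ b * f2) <-> coprime_roots f1 f2.
Proof.
have sgn c (f : {poly int}) (z : algC) :
    root (map_poly intr ((-1) ^+ c * f)) z = root (map_poly intr f) z.
  by rewrite rmorphM rmorph_sign !rootE hornerM horner_exp !hornerE mulf_eq0 signr_eq0.
by split=> h z; have := h z; rewrite !sgn.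
Qed.

Lemma detC_neq0 (f1 f2 : {poly int}) :
  coprime_roots f1 f2 -> \det (Cmx f1 f2) != 0.
Proof. by move=> h; apply/eqP => /detC_eq0_root [z]; apply/negP. Qed.

Lemma coprime_roots_detC (f1 f2 : {poly int}) :
  f2 != 0 -> \det (Cmx f1 f2) != 0 -> coprime_roots f1 f2.
Proof.
move=> f20 d0 z; apply/negP => /andP[/rootP r1 /rootP r2].
(* For D = 0 the determinant is the empty one and carries no information; [f2] is then a nonzero
   constant. *)
have [D0|] := posnP (maxdeg f1 f2).
  case/negP: f20; move: r2; rewrite (@size1_polyC _ f2); last first.
    by move: D0; rewrite /maxdeg; case: (size f2) => [|[]] //=; lia.
  by rewrite map_polyC hornerC /= => /eqP; rewrite intr_eq0 => /eqP ->.
case/detC_bezout => u [v] /(congr1 (fun f => (map_poly intr f).[z])).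
rewrite map_polyC hornerC rmorphD !rmorphM hornerD !hornerM r1 r2 !mul0r addr0.
by move/esym/eqP; rewrite intr_eq0 (negbTE d0).
Qed.

(* A common root [z] of [g1 + t h1] and [g2 + t h2] is a root of
   [g1 h2 - g2 h1], and it determines [t]: there are finitely many bad [t]. *)
Lemma exists_coprime_perturbation (g1 g2 h1 h2 : {poly int}) (p N : nat) :
  (1 < p)%N -> coprime_roots h1 h2 -> g1 * h2 - g2 * h1 != 0 ->
  (size (g1 * h2 - g2 * h1)%R <= N)%N ->
  exists i, [/\ (0 < i)%N, (i <= N)%N &
    coprime_roots (g1 + p%:R ^+ i * h1) (g2 + p%:R ^+ i * h2)].
Proof.
move=> p1 coh W0 sW; apply: boolp.contrapT => none.
pose toC : {poly int} -> {poly algC} := map_poly intr.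
have toCE g h i z : (toC (g + p%:R ^+ i * h)).[z] =
    (toC g).[z] + p%:R ^+ i * (toC h).[z].
  rewrite /toC rmorphD rmorphM rmorphXn rmorph_nat hornerD hornerM horner_exp.
  by rewrite -polyC_natr hornerC.
have bad (i : 'I_N) : exists z : algC,
    (toC g1).[z] + p%:R ^+ i.+1 * (toC h1).[z] = 0 /\
    (toC g2).[z] + p%:R ^+ i.+1 * (toC h2).[z] = 0.
  apply: boolp.contrapT => nz; apply: none; exists i.+1; split=> // z.
  apply/negP => /andP[/rootP r1 /rootP r2]; apply: nz; exists z.
  by rewrite -!toCE.
have [z zP] := fin_all_exists bad.
have zI : injective z.
  move=> i j zij; have [a1 a2] := zP i; have [] := zP j; rewrite -zij => b1 b2.
  apply/val_inj => /=; apply/eqP; apply: contraT => ij.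
  have pij : p%:R ^+ i.+1 - p%:R ^+ j.+1 != 0 :> algC.
    by rewrite subr_eq0 -!natrX eqr_nat eqn_exp2l.
  have root0 g h : (toC g).[z i] + p%:R ^+ i.+1 * (toC h).[z i] = 0 ->
     (toC g).[z i] + p%:R ^+ j.+1 * (toC h).[z i] = 0 -> root (toC h) (z i).
    move=> e1 e2; apply/rootP; apply: (mulfI pij); rewrite mulr0 mulrBl.
    rewrite (_ : _ - _ = ((toC g).[z i] + p%:R ^+ i.+1 * (toC h).[z i]) -
      ((toC g).[z i] + p%:R ^+ j.+1 * (toC h).[z i])); last by ring.
    by rewrite e1 e2 subr0.
  by have := coh (z i); rewrite (root0 g1) // (root0 g2).
have : all (root (toC (g1 * h2 - g2 * h1))) (codom z).
  apply/allP => _ /codomP[i ->]; have [a1 a2] := zP i; apply/rootP.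
  rewrite /toC rmorphB !rmorphM hornerD hornerN !hornerM.
  rewrite (eqP (_ : (toC g1).[z i] == - (p%:R ^+ i.+1 * (toC h1).[z i]))); last first.
    by rewrite -addr_eq0 a1.
  rewrite (eqP (_ : (toC g2).[z i] == - (p%:R ^+ i.+1 * (toC h2).[z i]))); last first.
    by rewrite -addr_eq0 a2.
  by ring.
move/max_poly_roots; rewrite map_inj_uniq ?enum_uniq // size_codom card_ord.
have Winj : injective (intr : int -> algC) := @intr_inj _.
rewrite size_map_inj_poly // map_poly_eq0_id0 ?intr_eq0 ?lead_coef_eq0 //.
by move/(_ W0 isT); rewrite ltnNge sW.
Qed.

(** * The loop of the algorithm *)

(** With [rho = bump h], which skips row [h], this is up to sign the entry of index [h] in the last
    row of the adjugate of the top-left block of size s + 1. Indices in [nat] let blocks of all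
    sizes share one [F]. *)
Definition lminor (A : comNzRingType) (F : nat -> nat -> A) (rho : nat -> nat)
    (s : nat) : A :=
  \det (\matrix_(i < s, j < s) F (rho i) j).

Lemma lminor_eq (A : comNzRingType) (F G : nat -> nat -> A) rho s :
  (forall i j, (i < s)%N -> (j < s)%N -> F (rho i) j = G (rho i) j) ->
  lminor F rho s = lminor G rho s.
Proof. by move=> FG; congr (\det _); apply/matrixP => i j; rewrite !mxE FG. Qed.

Lemma lminor_rmorph (A B : comNzRingType) (phi : {rmorphism A -> B})
    (F : nat -> nat -> A) rho s :
  phi (lminor F rho s) = lminor (fun i j => phi (F i j)) rho s.
Proof. by rewrite -det_map_mx; congr (\det _); apply/matrixP => i j; rewrite !mxE. Qed.

(** The determinant is affine in its last row, and the cofactor of the corner entry that receives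
    [t] is the minor of size [s]. *)
Lemma lminor_affine (A : comNzRingType) (F G : nat -> nat -> A) rho s t :
  (forall i j, (i < s)%N -> (j <= s)%N -> G (rho i) j = F (rho i) j) ->
  (forall j, (j <= s)%N -> G (rho s) j = F (rho s) j + t * (j == s)%:R) ->
  lminor G rho s.+1 = lminor F rho s.+1 + t * lminor F rho s.
Proof.
move=> eqGF lastG; rewrite /lminor !(expand_det_row _ ord_max).
under eq_bigr => j _.
  rewrite mxE lastG ?leq_ord // mulrDl (_ : cofactor _ _ _ =
    cofactor (\matrix_(i < s.+1, j < s.+1) F (rho i) j) ord_max j); last first.
    congr (_ * \det _); apply/matrixP => a b; rewrite !mxE lift_max.
    by rewrite eqGF // leq_ord.
  over.
rewrite big_split /=; congr (_ + _); first by apply: eq_bigr => j _; rewrite !mxE.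
rewrite (bigD1 ord_max) //= eqxx mulr1 big1 ?addr0 => [|j jm]; last first.
  by rewrite (_ : (j == s :> nat) = false) ?mulr0 ?mul0r //; apply/negbTE: jm.
congr (_ * _); rewrite /cofactor -signr_odd oddD addbb mul1r.
by congr (\det _); apply/matrixP => a b; rewrite !mxE !lift_max.
Qed.

Lemma size_lminor (F : nat -> nat -> {poly int}) rho s :
  (forall i j, (i < s)%N -> (j < s)%N -> size (F (rho i) j) <= 2)%N ->
  (size (lminor F rho s) <= s.+1)%N.
Proof.
move=> sF; rewrite /lminor /determinant.
apply: leq_trans (size_sum _ _ _) _; apply/bigmax_leqP => sg _.
rewrite size_Msign; apply: leq_trans (size_poly_prod_leq _ _) _.
rewrite leq_subLR card_ord addnS ltnS addnn -muln2.
rewrite -[X in (_ <= X * _)%N](card_ord s) -sum_nat_const.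
by apply: leq_sum => i _; rewrite mxE sF.
Qed.

Definition entries (n : nat) (A : Type) (B : 'M[A]_n.+2) (i j : nat) : A :=
  B (inord i) (inord j).

Lemma adj_topleft (n k : nat) (B : 'M[{poly int}]_n.+2) (h : 'I_k.+2) :
  \adj (topleft k.+2 B) ord_max h =
  (-1) ^+ (h + k.+1) * lminor (entries B) (bump h) k.+1.
Proof.
rewrite mxE /cofactor; congr (_ * \det _); apply/matrixP => i j.
by rewrite !mxE /entries lift_max.
Qed.

Lemma detC_topleftP (n k : nat) (B : 'M[{poly int}]_n.+2) :
  lminor (entries B) (bump 1) k.+1 != 0 ->
  (detC_adj (topleft k.+2 B) != 0 <->
   coprime_roots (lminor (entries B) (bump 0) k.+1)
                 (lminor (entries B) (bump 1) k.+1)).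
Proof.
move=> l0; rewrite /detC_adj !adj_topleft; split => [|h].
  move/coprime_roots_detC; rewrite mulf_eq0 signr_eq0 (negbTE l0).
  by move/(_ isT)/coprime_roots_sign.
by apply/detC_neq0/coprime_roots_sign.
Qed.

Lemma inord_eq (n i j : nat) : (i < n.+1)%N -> (j < n.+1)%N ->
  ((inord i : 'I_n.+1) == inord j) = (i == j).
Proof.
move=> hi hj; apply/eqP/eqP => [|-> //].
by move/(congr1 val) => /=; rewrite !inordK.
Qed.

Lemma perturb_entries (n p k t : nat) (B : 'M[{poly int}]_n.+2) i j :
  (k <= n)%N -> (i < n.+2)%N -> (j < n.+2)%N ->
  entries (perturb p k t B) i j = entries B i j
    + p%:R * ((i == k.+1) && (j == 0)%N)%:R
    + p%:R ^+ t * ((i == k.+1) && (j == k))%:R.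
Proof.
move=> kn hi hj; rewrite /entries /perturb !mxE.
have -> : (0 : 'I_n.+2) = inord 0 by apply/val_inj; rewrite /= inordK.
by rewrite !inord_eq // ltnS ltnW.
Qed.

(* After [K] rounds the matrix is [x adj M + perturbation], with 0-based indices. *)
Definition perturbation (A : pzRingType) (p : nat) (e : nat -> nat) (K i j : nat) : A :=
  p%:R * (i == j)%:R +
  ((0 < i)%N && (i <= K)%N)%:R * (p%:R * (j == 0%N)%:R + p%:R ^+ e i.-1 * (j == i.-1)%:R).

Lemma loop_entries (n : nat) (M : 'M[int]_n.+2) p e K i j :
  (K <= n.+1)%N -> (i < n.+2)%N -> (j < n.+2)%N ->
  entries (loop_mx M p e K) i j =
  'X * (entries (\adj M) i j)%:P + perturbation {poly int} p e K i j.
Proof.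
move=> hK hi hj; elim: K hK => [_|K IH hK] /=.
  rewrite /entries /perturbation /= !mxE inord_eq // leqn0.
  by case: i hi => [|i] hi /=; rewrite mul0r addr0 mulr_natr.
rewrite perturb_entries // IH 1?ltnW // -!addrA; congr (_ + _).
rewrite /perturbation; congr (_ + _).
have [->|iK] := eqVneq i K.+1; first by rewrite ltnn leqnn /= mul0r add0r mul1r.
rewrite !mulr0 !addr0 (_ : (i <= K.+1)%N = (i <= K)%N) //.
by rewrite leq_eqVlt (negbTE iK).
Qed.

Lemma rmorph_perturbation (A B : pzRingType) (phi : {rmorphism A -> B}) p e K i j :
  phi (perturbation A p e K i j) = perturbation B p e K i j.
Proof. by rewrite /perturbation !(rmorphD, rmorphM, rmorphXn, rmorph_nat). Qed.

Lemma loop_entries0 (n : nat) (M : 'M[int]_n.+2) p e K i j :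
  (K <= n.+1)%N -> (i < n.+2)%N -> (j < n.+2)%N ->
  (entries (loop_mx M p e K) i j).[0] = perturbation int p e K i j.
Proof.
move=> hK hi hj; rewrite loop_entries // hornerD hornerM hornerX mul0r add0r.
by rewrite -(rmorph_perturbation polyC) hornerC.
Qed.

Lemma size_XCaddC (a b : int) : (size ('X * a%:P + b%:P)%R <= 2)%N.
Proof.
rewrite mulrC size_MXaddC; case: ifP => // _.
by rewrite ltnS size_polyC leq_b1.
Qed.

Lemma size_loop_entries (n : nat) (M : 'M[int]_n.+2) p e K i j :
  (K <= n.+1)%N -> (i < n.+2)%N -> (j < n.+2)%N ->
  (size (entries (loop_mx M p e K) i j) <= 2)%N.
Proof.
move=> hK hi hj; rewrite loop_entries // -(rmorph_perturbation polyC).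
exact: size_XCaddC.
Qed.

(** * The two cofactors and their values at 0 *)

Definition before_power (n : nat) (M : 'M[int]_n.+2) p e (k i j : nat) : {poly int} :=
  entries (loop_mx M p e k) i j + p%:R * ((i == k.+1) && (j == 0)%N)%:R.

(** For 0 < k the row [k.+1] treated in the round is the last row of both minors, and the power of p
    enters it in their last column. *)
Lemma lminor_perturb (n : nat) (M : 'M[int]_n.+2) p e k t h :
  (0 < k)%N -> (k <= n)%N -> (h <= 1)%N ->
  lminor (entries (perturb p k t (loop_mx M p e k))) (bump h) k.+1 =
  lminor (before_power M p e k) (bump h) k.+1 +
  p%:R ^+ t * lminor (entries (loop_mx M p e k)) (bump h) k.
Proof.
move=> k0 kn h1; have bk i : (i < k)%N -> (bump h i < k.+1)%N by rewrite /bump; lia.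
have bkk : bump h k = k.+1 by rewrite /bump; lia.
rewrite (@lminor_affine _ (before_power M p e k) _ (bump h) k (p%:R ^+ t)).
- congr (_ + _ * _); apply: lminor_eq => i j /bk ik jk.
  rewrite /before_power (_ : (bump h i == k.+1) = false) /= ?mulr0 ?addr0 //; lia.
- move=> i j /bk ik jk; rewrite perturb_entries //; [|lia..].
  rewrite /before_power (_ : (bump h i == k.+1) = false) /= ?mulr0 ?addr0 //; lia.
- by move=> j jk; rewrite bkk perturb_entries /before_power ?eqxx //; lia.
Qed.

Lemma lminor_horner0 (F : nat -> nat -> {poly int}) rho s :
  (lminor F rho s).[0] = lminor (fun i j => (F i j).[0]) rho s.
Proof. exact: (lminor_rmorph (horner_eval (0 : int))). Qed.

Lemma before_power0 (n : nat) (M : 'M[int]_n.+2) p e k i j :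
  (k <= n)%N -> (i < n.+2)%N -> (j < n.+2)%N ->
  (before_power M p e k i j).[0] = perturbation int p e k i j +
    p%:R * ((i == k.+1) && (j == 0)%N)%:R.
Proof.
move=> kn hi hj; rewrite /before_power hornerD loop_entries0 ?(leq_trans kn) //.
by rewrite -!polyC_natr -polyCM hornerC.
Qed.

(** At 0 two rows agree: row [k.+1], whose diagonal entry lies outside the first [k.+1] columns, and
    row 0 are both p times the first basis vector. *)
Lemma before_power_minor2 (n : nat) (M : 'M[int]_n.+2) p e k :
  (0 < k)%N -> (k <= n)%N ->
  (lminor (before_power M p e k) (bump 1) k.+1).[0] = 0.
Proof.
move=> k0 kn; rewrite lminor_horner0 /lminor.
apply: (@determinant_alternate _ _ _ ord0 ord_max); first by rewrite -val_eqE /= neq_ltn k0.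
move=> j; rewrite !mxE /= (_ : bump 1 k = k.+1); last by rewrite /bump; lia.
have jk := ltn_ord j; rewrite !before_power0 //; [|lia..].
rewrite /perturbation /= !ltnn ?andbF ?mul0r ?mulr0 ?addr0 eqxx.
rewrite (_ : (k.+1 == j) = false) ?mulr0 ?add0r; last lia.
by rewrite eq_sym.
Qed.

(** At 0 the last row is p times the first basis vector; deleting it and the first column leaves a
    lower triangular matrix with p on the diagonal. *)
Lemma before_power_minor1 (n : nat) (M : 'M[int]_n.+2) p e k :
  (0 < p)%N -> (0 < k)%N -> (k <= n)%N ->
  (lminor (before_power M p e k) (bump 0) k.+1).[0] != 0.
Proof.
move=> p0 k0 kn; rewrite lminor_horner0 /lminor (expand_det_row _ ord_max).
have lastE (j : 'I_k.+1) : (before_power M p e k k.+1 j).[0] = p%:R * (j == 0)%:R.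
  have jk := ltn_ord j; rewrite before_power0 //; [|lia..].
  rewrite /perturbation ltnn andbF mul0r addr0 eqxx.
  by rewrite (_ : (k.+1 == j) = false) ?mulr0 ?add0r //; lia.
rewrite (bigD1 ord0) //= big1 => [|j j0]; last first.
  by rewrite mxE lastE (negbTE j0) mulr0 mul0r.
rewrite mxE lastE eqxx mulr1 addr0 !mulf_neq0 ?signr_eq0 ?pnatr_eq0 -?lt0n //.
rewrite det_trig; last first.
  apply/is_trig_mxP => i j ij; have /= ik := ltn_ord i; have /= jk := ltn_ord j.
  rewrite !mxE lift_max before_power0; [|rewrite /= /bump; lia..].
  rewrite /perturbation /= /bump /= !add1n eqSS.
  have -> : (i == j :> nat) = false by lia.
  have -> : (j.+1 == i) = false by lia.
  by rewrite ?andbF !(mulr0, addr0).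
apply/prodf_neq0 => i _; have /= ik := ltn_ord i.
rewrite !mxE lift_max before_power0; [|rewrite /= /bump; lia..].
rewrite /perturbation /= /bump /= !add1n eqSS eqxx.
rewrite (_ : (i.+1 == i) = false) ?mulr0 ?addr0 ?mulr1 ?andbF; last lia.
by rewrite mulr0 addr0 pnatr_eq0 -lt0n.
Qed.

(** The value at 0 is p after the first round, and each later round multiplies it by the chosen
    power of p, because the other term of [lminor_perturb] vanishes at 0. *)
Lemma loop_minor2 (n : nat) (M : 'M[int]_n.+2) p e K :
  (0 < K)%N -> (K <= n.+1)%N ->
  exists N, (lminor (entries (loop_mx M p e K)) (bump 1) K).[0] = p%:R ^+ N.
Proof.
case: K => // K _; elim: K => [|K IH] hK.
  exists 1%N; rewrite lminor_horner0 /lminor det_mx11 mxE loop_entries0 //.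
  by rewrite /perturbation /= mul0r addr0 mulr1.
have [|N IHN] := IH; first exact: ltnW.
exists (e K.+1 + N)%N; rewrite -[loop_mx M p e K.+2]/(perturb p K.+1 (e K.+1) (loop_mx M p e K.+1)).
rewrite lminor_perturb //.
rewrite hornerD before_power_minor2 // add0r hornerM -polyC_natr horner_exp hornerC.
by rewrite IHN exprD.
Qed.

Lemma loop_minor2_neq0 (n : nat) (M : 'M[int]_n.+2) p e K :
  (0 < p)%N -> (0 < K)%N -> (K <= n.+1)%N ->
  lminor (entries (loop_mx M p e K)) (bump 1) K != 0.
Proof.
move=> p0 K0 /(loop_minor2 M p e K0)[N EN]; apply/eqP => l0.
by move: EN; rewrite l0 horner0 => /esym/eqP; rewrite expf_eq0 pnatr_eq0 eqn0Ngt p0 andbF.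
Qed.

(** The perturbation lemma applies with [g] the minors in the middle of the round and [g'] those
    left by the previous round. The latter are coprime by [prev], and at 0 the polynomial g1 h2 - g2
    h1 is a product of two nonzero values. *)
Lemma exists_good_exponent (n : nat) (M : 'M[int]_n.+2) p e k :
  (1 < p)%N -> (k <= n)%N ->
  (forall l, (l < k)%N -> detC_adj (topleft l.+2 (loop_mx M p e l.+1)) != 0) ->
  exists i, [/\ (0 < i)%N, (i <= k.*2.+2)%N &
    detC_adj (topleft k.+2 (perturb p k i (loop_mx M p e k))) != 0].
Proof.
move=> p1 kn prev; have p0 := ltnW p1.
pose g h := lminor (before_power M p e k) (bump h) k.+1.
(* In round 0 the minors have size 1: the power of p enters the one for [h = 0] with coefficient 1,
   while the one for [h = 1] lies in row 0 and does not change. *)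
pose g' h := if k == 0%N then (h == 0%N)%:R else lminor (entries (loop_mx M p e k)) (bump h) k.
have fE t h : (h <= 1)%N ->
    lminor (entries (perturb p k t (loop_mx M p e k))) (bump h) k.+1 = g h + p%:R ^+ t * g' h.
  case: (posnP k) => [k0|k0] h1; last first.
    by rewrite lminor_perturb //; rewrite /g' eqn0Ngt k0.
  by case: h h1 => [|[]] // _; rewrite /g /g' k0 /lminor !det_mx11 !mxE perturb_entries.
have W0 : g 0%N * g' 1%N - g 1%N * g' 0%N != 0.
  case: (posnP k) => [k0|k0].
    rewrite /g /g' k0 /= mulr0 mulr1 sub0r oppr_eq0 /lminor det_mx11 mxE.
    apply/eqP => /(congr1 (fun f => f.[0])); rewrite before_power0 // horner0.
    by rewrite /perturbation /= mulr1 mul0r mulr0 !addr0 => /eqP; rewrite pnatr_eq0; lia.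
  apply/eqP => /(congr1 (fun f => f.[0])).
  rewrite hornerD hornerN !hornerM horner0 before_power_minor2 // mul0r subr0.
  have [|N] := loop_minor2 M p e k0 _; first by lia.
  rewrite /g' eqn0Ngt k0 /= => -> /eqP; rewrite mulf_eq0 expf_eq0 pnatr_eq0.
  by rewrite (negbTE (before_power_minor1 _ _ _ _ _)) // eqn0Ngt p0 andbF.
have sg h : (h <= 1)%N -> (size (g h) <= k.+2)%N.
  move=> h1; apply: size_lminor => i j ik jk.
  have hi : (bump h i < n.+2)%N by rewrite /bump; lia.
  rewrite /before_power loop_entries -?(rmorph_perturbation polyC); [|lia..].
  by rewrite -!polyC_natr -!polyCM -addrA -polyCD size_XCaddC.
have sg' h : (h <= 1)%N -> (size (g' h) <= k.+1)%N.
  move=> h1; rewrite /g'; case: eqP => [->|/eqP k0].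
    by case: eqP => _; rewrite ?size_poly1 ?size_poly0.
  apply: size_lminor => i j ik jk; apply: size_loop_entries; rewrite ?/bump; lia.
(* Sizes k + 2 and k + 1 give products of size at most 2 k + 2, which becomes the bound on the
   exponent. *)
have sW : (size (g 0%N * g' 1%N - g 1%N * g' 0%N)%R <= k.*2.+2)%N.
  apply: leq_trans (size_polyD _ _) _; rewrite size_polyN geq_max.
  apply/andP; split; apply: leq_trans (size_polyMleq _ _) _; rewrite -subn1 leq_subLR.
    by apply: leq_trans (leq_add (sg 0%N isT) (sg' 1%N isT)) _; lia.
  by apply: leq_trans (leq_add (sg 1%N isT) (sg' 0%N isT)) _; lia.
have coh : coprime_roots (g' 0%N) (g' 1%N).
  rewrite /g'; case: eqP => [_ z|/eqP]; first by rewrite rmorph1 rootC oner_eq0.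
  rewrite -lt0n => k0; rewrite -(prednK k0); move: (prednK k0).
  move: k.-1 => l lk; have := prev l; rewrite -{1}lk => /(_ (leqnn _)).
  have lm0 : lminor (entries (loop_mx M p e l.+1)) (bump 1) l.+1 != 0.
    by apply: loop_minor2_neq0; rewrite // lk ltnW.
  exact: (detC_topleftP lm0).1.
have [i [i0 iN ci]] := exists_coprime_perturbation p1 coh W0 sW.
exists i; split=> //; move: ci; rewrite -!fE // => ci.
rewrite /detC_adj !adj_topleft; exact/detC_neq0/coprime_roots_sign.
Qed.

(** * Existence and size of the exponents *)

Lemma eq_loop_mx (n : nat) (M : 'M[int]_n.+2) p e e' K :
  (forall k, (k < K)%N -> e k = e' k) -> loop_mx M p e K = loop_mx M p e' K.
Proof.
elim: K => //= K IH ee'; rewrite IH ?ee' // => k kK.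
by rewrite ee' // ltnS ltnW.
Qed.

Definition is_loop_run (n : nat) (M : 'M[int]_n.+2) p (e : nat -> nat) K :=
  forall k, (k < K)%N -> is_least
    (fun i => (0 < i)%N /\
       detC_adj (topleft k.+2 (perturb p k i (loop_mx M p e k))) != 0) (e k).

Lemma loop_run_bound (n : nat) (M : 'M[int]_n.+2) p e k :
  (1 < p)%N -> is_loop_run M p e n.+1 -> (k <= n)%N ->
  (0 < e k)%N /\ (e k <= k.*2.+2)%N.
Proof.
move=> p1 run kn; have [[e0 _] emin] := run k kn; split=> //.
have [|i [i0 ik di]] := @exists_good_exponent _ M p e k p1 kn.
  by move=> l lk; have [[]] := run l (leq_trans lk (leqW kn)).
by apply: leq_trans ik; apply: emin.
Qed.

Lemma exists_least (P : nat -> Prop) : (exists k, P k) -> exists k, is_least P k.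
Proof.
move=> [k Pk]; have exP : exists k, `[< P k >] by exists k; apply/boolp.asboolP.
case: (ex_minnP exP) => m /boolp.asboolP Pm mmin; exists m; split=> // l Pl.
by apply: mmin; apply/boolp.asboolP.
Qed.

Lemma exists_loop_run (n : nat) (M : 'M[int]_n.+2) p : (1 < p)%N ->
  exists e, is_loop_run M p e n.+1.
Proof.
move=> p1; suff: forall K, (K <= n.+1)%N -> exists e, is_loop_run M p e K by apply.
elim=> [_|K IH hK]; first by exists id.
have [|e runK] := IH; first exact: ltnW.
have [|i [i0 _ di]] := @exists_good_exponent _ M p e K p1 hK.
  by move=> l lK; have [[]] := runK l lK.
have [|m mleast] := @exists_least (fun i => (0 < i)%N /\
  detC_adj (topleft K.+2 (perturb p K i (loop_mx M p e K))) != 0); first by exists i.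
pose e' k := if k == K then m else e k.
have e'E k : (k < K)%N -> e' k = e k by rewrite /e' => /ltn_eqF ->.
exists e' => k; rewrite ltnS leq_eqVlt => /predU1P[->|kK].
  by rewrite (@eq_loop_mx _ _ _ e' e) // /e' eqxx.
have -> : loop_mx M p e' k = loop_mx M p e k.
  by apply: eq_loop_mx => l lk; rewrite e'E // (ltn_trans lk).
by rewrite e'E //; apply: runK.
Qed.

(** * Products of small primes *)

Local Open Scope nat_scope.

Definition primorial (p : nat) : nat := \prod_(q < p | prime q) q.

Lemma primorial_gt0 p : (0 < primorial p)%N.
Proof. by apply: prodn_cond_gt0 => q; apply: prime_gt0. Qed.

Lemma primorial_dvd (p N : nat) :
  (forall q, prime q -> (q < p)%N -> q %| N) -> primorial p %| N.
Proof.
elim: p => [|p IH] h; first by rewrite /primorial big_ord0 dvd1n.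
rewrite /primorial big_mkcond big_ord_recr /= -big_mkcond -/(primorial p).
have pN : primorial p %| N by apply: IH => q qp qlt; apply: h => //; exact: ltnW.
case: ifP => pp; last by rewrite muln1.
rewrite Gauss_dvd ?pN ?h // coprime_sym prime_coprime //.
rewrite /primorial; elim/big_ind: _ => [|x y hx hy|q qp].
- by rewrite dvdn1; case: p pp {IH h pN} => [|[]].
- by rewrite Euclid_dvdM // negb_or hx.
by rewrite dvdn_prime2 // neq_ltn ltn_ord orbT.
Qed.

Lemma primorial_ge (p : nat) (s : seq nat) :
  uniq s -> all prime s -> all (fun q => q < p)%N s ->
  (\prod_(q <- s) q <= primorial p)%N.
Proof.
move=> us ps sp; apply: dvdn_leq (primorial_gt0 p) _.
have {sp} : all (fun q => q %| primorial p) s.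
  apply/allP => q qs; have qp := allP sp q qs.
  by rewrite /primorial (bigD1 (Ordinal qp)) /= ?(allP ps) // dvdn_mulr.
elim: s us ps => [|q s IH] /=; first by rewrite big_nil dvd1n.
case/andP=> qs us /andP[pq ps] /andP[qd sd]; rewrite big_cons Gauss_dvd ?qd ?IH //.
rewrite prime_coprime // big_seq; elim/big_ind: _.
- by rewrite dvdn1; case: q pq {qs qd} => [|[]].
- by move=> x y hx hy; rewrite Euclid_dvdM // negb_or hx.
move=> x xs; rewrite dvdn_prime2 ?(allP ps x xs) //.
by apply/eqP => qx; rewrite qx xs in qs.
Qed.

(** By Legendre's formula the valuation is the sum over k of floor(2n / q^k) - 2 floor(n / q^k).
    Each term is 0 or 1, and it is 0 once q^k exceeds 2n. *)
Lemma logn_bin_central (q n : nat) : prime q ->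
  (logn q 'C(n.*2, n) <= trunc_log q n.*2)%N.
Proof.
move=> pq; have q1 := prime_gt1 pq.
have nn : (n <= n.*2)%N by rewrite -addnn leq_addr.
have := congr1 (logn q) (bin_fact nn).
rewrite !lognM ?muln_gt0 ?bin_gt0 ?fact_gt0 // -{2}addnn addnK !logn_fact //.
set L := trunc_log q n.*2.
have widen : \sum_(1 <= k < n.+1) n %/ q ^ k = \sum_(1 <= k < n.*2.+1) n %/ q ^ k.
  rewrite [RHS](@big_cat_nat _ _ _ n.+1) //= [X in _ + X](_ : _ = 0) ?addn0 //.
  rewrite big_nat_cond big1 // => k /andP[/andP[nk _] _]; rewrite divn_small // (leq_trans nk) //.
  exact/ltnW/ltn_expl.
rewrite widen => E.
have : (\sum_(1 <= k < n.*2.+1) n.*2 %/ q ^ k <=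
   \sum_(1 <= k < n.*2.+1) ((n %/ q ^ k + n %/ q ^ k) + (k <= L)%N))%N.
  apply: leq_sum => k _; have qk0 : (0 < q ^ k)%N by rewrite expn_gt0 prime_gt0.
  have [kL|Lk] := leqP k L.
    by rewrite -addnn divnD // leq_add2l leq_b1.
  rewrite divn_small // ltnNge; apply/negP => /(trunc_log_max q1).
  by rewrite leqNgt Lk.
rewrite !big_split /= -E addnC leq_add2l => /leq_trans; apply.
have -> N : \sum_(1 <= k < N.+1) (k <= L)%N = minn N L.
  elim: N => [|N IH]; first by rewrite big_geq // min0n.
  by rewrite big_nat_recr //= IH; lia.
exact: geq_minr.
Qed.

Lemma bin_central_ge (n : nat) : (4 ^ n <= n.*2.+1 * 'C(n.*2, n))%N.
Proof.
elim: n => [|n IH] //.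
have E : n.+1 * 'C(n.+1.*2, n.+1) = 2 * (n.*2.+1 * 'C(n.*2, n)).
  have h1 := mul_bin_diag n.+1.*2 n; have h2 := mul_bin_diag n.*2.+1 n.
  have h3 := mul_bin_left n.*2.+1 n.
  rewrite doubleS /= in h1 h2 h3 *; rewrite -h1.
  have -> : n.*2.+2 * 'C(n.*2.+1, n) = 2 * (n.+1 * 'C(n.*2.+1, n)) by rewrite -muln2; lia.
  by congr (2 * _); rewrite h2 h3; congr (_ * _); lia.
rewrite -(@leq_pmul2l n.+1) // mulnCA E expnS.
have : n.+1 * (4 * 4 ^ n) <= n.+1 * (4 * (n.*2.+1 * 'C(n.*2, n))).
  by rewrite !leq_mul2l IH !orbT.
move/leq_trans; apply; rewrite !mulnA leq_mul2r; apply/orP; right; rewrite -muln2; nia.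
Qed.

(** Every prime power in the factorization is at most 2n. A prime above [s] has square above 2n, so
    it occurs at most once and is absorbed by the primorial; the numbers up to [s] account for the
    factor (2n)^s. *)
Lemma bin_central_le (n s : nat) : 0 < n -> (n.*2 < s.+1 ^ 2)%N ->
  ('C(n.*2, n) <= primorial n.*2.+1 * n.*2 ^ s)%N.
Proof.
move=> n0 ns; set C := 'C(_, _).
have C0 : (0 < C)%N by rewrite bin_gt0 -addnn leq_addr.
pose m := maxn C (maxn n.*2 s).
rewrite -[X in (X <= _)%N](partnT C0) (@widen_partn m) ?leq_maxl // big_mkord /=.
have h (q : nat) : (q ^ logn q C <=
    (if prime q && (q < n.*2.+1) then q else 1) * (if 0 < q <= s then n.*2 else 1))%N.
  case pq: (prime q); last by rewrite lognE pq /=; case: ifP => _; rewrite expn0 ?mul1n ?double_gt0.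
  have q1 := prime_gt1 pq; have q0 := prime_gt0 pq; rewrite q0 /=.
  have lt := logn_bin_central n pq; rewrite -/C in lt.
  have le2n : (q ^ logn q C <= n.*2)%N.
    apply: leq_trans (leq_pexp2l q0 lt) _.
    by apply: trunc_logP; rewrite // double_gt0.
  case: (leqP q s) => qs.
    by apply: leq_trans le2n _; rewrite leq_pmull //; case: ifP.
  rewrite muln1 ltnS; case: (leqP q n.*2) => qn /=.
    rewrite -[X in (_ <= X)%N]expn1 leq_pexp2l // (leq_trans lt) // -ltnS.
    rewrite -(@ltn_exp2l q) // (leq_ltn_trans (trunc_logP _ _)) ?double_gt0 //.
    by apply: leq_trans ns _; rewrite leq_exp2r.
  rewrite -[X in (_ <= X)%N](expn0 q) leq_pexp2l // (leq_trans lt) // -ltnS.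
  by rewrite -(@ltn_exp2l q) // expn1 (leq_ltn_trans (trunc_logP _ _)) ?double_gt0.
apply: (leq_trans (leq_prod (fun (i : 'I_m.+1) _ => h i))); rewrite big_split /=.
apply: leq_mul.
  rewrite -big_mkcond /primorial -[X in (_ <= X)%N](big_mkord (fun q => prime q) id).
  by rewrite -(big_mkord (fun q => prime q && (q < n.*2.+1)%N) id)
    (@big_nat_widen _ _ _ 0 n.*2.+1 m.+1) // ltnS !leq_max leqnn orbT.
rewrite -big_mkcond /= prod_nat_const.
apply: leq_pexp2l; first by rewrite double_gt0.
rewrite -sum1_card -(big_mkord (fun i => 0 < i <= s)%N (fun=> 1%N)).
rewrite -[X in (_ <= X)%N]mul1n -[X in (_ <= _ * X)%N](subn0 s) -subSS.
rewrite -[X in (_ <= X)%N]mulnC -sum_nat_const_nat big_ltn_cond //= big_nat_cond.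
rewrite [X in (_ <= X)%N](@big_nat_widen _ _ _ 1 s.+1 m.+1) ?ltnS ?leq_max ?leqnn ?orbT //.
rewrite [X in (_ <= X)%N]big_nat_cond.
by rewrite leq_eqVlt; apply/orP; left; apply/eqP; apply: eq_bigl => i; lia.
Qed.

Lemma primorial_chebyshev (n s : nat) : 0 < n -> (n.*2.+1 < s.+1 ^ 2)%N ->
  (2 ^ n.*2 <= primorial n.*2.+1 * n.*2.+1 ^ s.+1)%N.
Proof.
move=> n0 ns; have := bin_central_ge n; rewrite -{1}[4]/(2 ^ 2)%N -expnM mul2n => /leq_trans; apply.
rewrite expnS mulnCA leq_mul2l; apply/orP; right.
apply: leq_trans (bin_central_le n0 (ltnW ns)) _.
have s0 : 0 < s by case: s ns => [|s] //; rewrite exp1n; lia.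
by rewrite leq_mul2l leq_exp2r ?leqnSn ?orbT.
Qed.

Local Open Scope ring_scope.

(** * Explicit bounds for logarithms and for the primorial *)

Lemma ln_le_sub1 (R : realType) (u : R) : 0 < u -> ln u <= u - 1.
Proof.
move=> u0; rewrite -[X in ln X](addrNK 1) addrC; apply: le_ln1Dx; lra.
Qed.

(** The telescoping product of 7/8, 6/7, 5/6 and 4/5 is 1/2; [ln u <= u - 1] on each factor yields
    1/8 + 1/7 + 1/6 + 1/5 > 5/8. *)
Lemma ln2_ge (R : realType) : 5 / 8 <= ln 2 :> R.
Proof.
have h : ln (7 / 8 * (6 / 7) * (5 / 6) * (4 / 5)) <= - (5 / 8) :> R.
  rewrite (@lnM _ _ (4 / 5)) ?posrE; [|lra..].
  rewrite (@lnM _ _ (5 / 6)) ?posrE; [|lra..].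
  rewrite (@lnM _ _ (6 / 7)) ?posrE; [|lra..].
  have h1 : ln (7 / 8) <= 7 / 8 - 1 :> R by apply: ln_le_sub1; lra.
  have h2 : ln (6 / 7) <= 6 / 7 - 1 :> R by apply: ln_le_sub1; lra.
  have h3 : ln (5 / 6) <= 5 / 6 - 1 :> R by apply: ln_le_sub1; lra.
  have h4 : ln (4 / 5) <= 4 / 5 - 1 :> R by apply: ln_le_sub1; lra.
  lra.
move: h; rewrite (_ : _ * (4 / 5) = 2^-1); last by lra.
rewrite lnV ?posrE; lra.
Qed.

(** This is the tangent bound at 5/2, a rational slightly below e; ln (5/2) <= 1 because 5/2 <=
    (9/8)^8. *)
Lemma ln_le_linear (R : realType) (u : R) : 0 < u -> ln u <= 2 / 5 * u.
Proof.
move=> u0.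
have e1 : ln (5 / 2) <= 1 :> R.
  apply: (@le_trans _ _ (ln ((9 / 8) ^+ 8))).
    by rewrite ler_ln ?posrE; lra.
  rewrite lnXn; last lra.
  have : ln (9 / 8) <= 9 / 8 - 1 :> R by apply: ln_le_sub1; lra.
  by rewrite -mulr_natr; lra.
have : ln (2 / 5 * u) <= 2 / 5 * u - 1 by apply: ln_le_sub1; lra.
have -> : 2 / 5 * u = u / (5 / 2) by lra.
rewrite ln_div ?posrE; lra.
Qed.

(* Here [w] is the sixth root of [p], so that the exponents 2/3 and 1/2 of [p]
   are integer powers of [w]; the bound is [ln u <= 2 u / 5] at
   [u = w ^ 4 / (2 k + 2)]. *)
Lemma primorial_power_bound (R : realType) (p k : nat) (w : R) :
  (0 < p)%N -> (0 < k)%N -> 0 < w -> w ^+ 6 = p%:R ->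
  ln 2 + 3 / 5 * w ^+ 4 < ln (primorial p)%:R ->
  (2 * p ^ (2 * k) < (2 * k + 2) ^ (3 * k) * primorial p)%N.
Proof.
move=> p0 k0 w0 wp hP; have P0 := primorial_gt0 p.
set K := (2 * k + 2)%N; have K0 : (0 < K)%N by rewrite /K; lia.
have KR : 0 < K%:R :> R by rewrite ltr0n.
rewrite -(ltr_nat R) !natrM !natrX -ltr_ln ?posrE; last 2 first.
- by rewrite mulr_gt0 ?exprn_gt0 ?ltr0n.
- by rewrite mulr_gt0 ?exprn_gt0 ?ltr0n.
rewrite lnM ?posrE ?exprn_gt0 ?ltr0n // lnM ?posrE ?exprn_gt0 ?ltr0n //.
rewrite !lnXn ?ltr0n // -[ln p%:R *+ _]mulr_natr -[ln K%:R *+ _]mulr_natr.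
have lp : ln p%:R = 6 * ln w by rewrite -wp lnXn // mulr_natl.
have w4 : 0 < w ^+ 4 by rewrite exprn_gt0.
have := @ln_le_linear R (w ^+ 4 / K%:R) (divr_gt0 w4 KR).
rewrite ln_div ?posrE // lnXn // -(mulr_natl (ln w)) => h.
have {}h : 3 * k%:R * (4 * ln w - ln K%:R) <= 3 * k%:R * (2 / 5 * (w ^+ 4 / K%:R)).
  by rewrite ler_pM2l ?mulr_gt0 ?ltr0n.
have hk : 3 * k%:R * (2 / 5 * (w ^+ 4 / K%:R)) <= 3 / 5 * w ^+ 4.
  have -> : 3 * k%:R * (2 / 5 * (w ^+ 4 / K%:R)) = 3 / 5 * w ^+ 4 * (2 * k%:R / K%:R) by lra.
  rewrite ler_piMr //; first lra.
  by rewrite ler_pdivrMr // mul1r -natrM ler_nat /K; lia.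
rewrite lp !natrM; lra.
Qed.

Lemma sixth_root (R : realType) (p : nat) : (0 < p)%N ->
  exists w : R, 0 < w /\ w ^+ 6 = p%:R.
Proof.
move=> p0; exists (p%:R `^ (6^-1)); split; first by rewrite powR_gt0 // ltr0n.
by rewrite -powR_mulrn ?powR_ge0 // -powRrM mulVf ?powRr1.
Qed.

Lemma sqr_le_of_cube (R : realType) (v u : R) :
  0 < v -> 0 < u -> v ^+ 3 <= u ^+ 3 -> v ^+ 2 <= u ^+ 2.
Proof.
move=> v0 u0 h; have vu : v <= u by rewrite -(@ler_pXn2r _ 3) // nnegrE ltW.
by rewrite ler_pXn2r // nnegrE ltW.
Qed.

(** As [u] is at least the cube root of p, p^(2/3) is at most u^2. The last hypothesis is ln 2 + 3/5
    u^2 < b ln 2 with ln 2 replaced by its lower bound 5/8. *)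
Lemma primorial_power_bound_pow2 (R : realType) (p k b : nat) (u : R) :
  (0 < p)%N -> (0 < k)%N -> 0 < u -> p%:R <= u ^+ 3 ->
  (2 ^ b <= primorial p)%N -> 3 / 5 * u ^+ 2 < 5 / 8 * (b%:R - 1) ->
  (2 * p ^ (2 * k) < (2 * k + 2) ^ (3 * k) * primorial p)%N.
Proof.
move=> p0 k0 u0 pu bP hu; have [w [w0 wp]] := sixth_root R p0.
apply: (primorial_power_bound p0 k0 w0 wp).
have w4 : w ^+ 4 <= u ^+ 2.
  rewrite (_ : w ^+ 4 = (w ^+ 2) ^+ 2); last by rewrite -exprM.
  by apply: sqr_le_of_cube; rewrite ?exprn_gt0 // -exprM wp.
have : ln (2 ^+ b) <= ln (primorial p)%:R :> R.
  by rewrite ler_ln ?posrE ?exprn_gt0 ?ltr0n ?primorial_gt0 // -natrX ler_nat.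
rewrite lnXn // -(mulr_natl (ln 2)) => h; have l2 := @ln2_ge R.
have b1 : 0 < b%:R - 1 :> R by have := exprn_gt0 2 u0; lra.
have : (b%:R - 1) * (5 / 8) <= (b%:R - 1) * ln 2 :> R by rewrite ler_pM2l.
lra.
Qed.

(** The Chebyshev bound is used with 2n + 1 = p and [s] the integer part of the square root w^3 of
    p. With ln p <= 12/5 w, a polynomial inequality in v = p^(1/3) remains; 584/100 is just below
    the cube root of 200. *)
Lemma primorial_power_bound_large (R : realType) (p k : nat) :
  prime p -> (200 <= p)%N -> (0 < k)%N ->
  (2 * p ^ (2 * k) < (2 * k + 2) ^ (3 * k) * primorial p)%N.
Proof.
move=> pp p200 k0; have p0 := prime_gt0 pp; have [w [w0 wp]] := sixth_root R p0.
apply: (primorial_power_bound p0 k0 w0 wp).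
have p1R : 200 <= w ^+ 6 by rewrite wp (ler_nat R 200 p).
pose v := w ^+ 2; have v0 : 0 < v by rewrite exprn_gt0.
have v3 : w ^+ 6 = v ^+ 3 by rewrite /v -exprM.
have v58 : 584 / 100 <= v.
  rewrite leNgt; apply/negP => h.
  have : v ^+ 3 < (584 / 100) ^+ 3 by rewrite ltr_pXn2r // nnegrE; lra.
  lra.
have odd_p : odd p by case: (even_prime pp) => [E|//]; rewrite E in p200.
have pE : p = p./2.*2.+1 by rewrite -[LHS]odd_double_half odd_p.
pose s := Num.trunc (w ^+ 3).
have w30 : 0 <= w ^+ 3 by rewrite exprn_ge0 // ltW.
have /andP[s1 s2] := Num.Theory.trunc_itv w30.
have ps : (p < s.+1 ^ 2)%N.
  rewrite -(ltr_nat R) natrX -wp (_ : w ^+ 6 = (w ^+ 3) ^+ 2); last by rewrite -exprM.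
  by rewrite ltr_pXn2r // nnegrE.
have := @primorial_chebyshev p./2 s; rewrite -pE => /(_ _ ps).
have -> : p./2.*2 = p.-1 by rewrite [in RHS]pE.
have h2 : (0 < p./2)%N by rewrite half_gt0; apply: leq_trans p200.
move/(_ h2); rewrite -(ler_nat R) natrM !natrX -ler_ln;
  rewrite ?posrE ?mulr_gt0 ?exprn_gt0 ?ltr0n ?primorial_gt0 //.
rewrite lnM ?posrE ?exprn_gt0 ?ltr0n ?primorial_gt0 // !lnXn ?ltr0n //.
rewrite -[ln 2 *+ _]mulr_natl -[ln p%:R *+ _]mulr_natl.
have lp : ln p%:R = 6 * ln w by rewrite -wp lnXn // mulr_natl.
have lw := ln_le_linear w0; have l2 := @ln2_ge R.
have -> : p.-1%:R = w ^+ 6 - 1 :> R by rewrite wp -subn1 natrB.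
have w2 : 2 <= w.
  rewrite leNgt; apply/negP => h.
  have : v < 2 ^+ 2 by rewrite ltr_pXn2r // nnegrE; lra.
  lra.
have hs : s.+1%:R * ln p%:R <= (w ^+ 3 + 1) * (6 * (2 / 5 * w)).
  rewrite lp; apply: ler_pM => //; last lra.
    by rewrite mulr_ge0 // ln_ge0 //; lra.
  by rewrite -natr1; lra.
have wv : w <= v / 2.
  rewrite /v expr2; nra.
have h5 : (w ^+ 6 - 2) * (5 / 8) <= (w ^+ 6 - 2) * ln 2 by rewrite ler_pM2l //; lra.
have w4 : w ^+ 4 = v ^+ 2 by rewrite /v -exprM.
move: hs; rewrite (_ : (w ^+ 3 + 1) * (6 * (2 / 5 * w)) = 12 / 5 * w ^+ 4 + 12 / 5 * w);
  last by ring.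
rewrite w4 v3 in h5 *.
suff : 3 * v ^+ 2 + 12 / 5 * (v / 2) < (v ^+ 3 - 2) * (5 / 8) by lra.
have : 0 <= (v - 584 / 100) * v ^+ 2 by rewrite mulr_ge0 ?subr_ge0 // exprn_ge0 // ltW.
have : 0 <= (v - 584 / 100) * v by rewrite mulr_ge0 ?subr_ge0 // ltW.
rewrite !exprS expr0; nra.
Qed.

Lemma primorial_power_bound_all (R : realType) (p k : nat) :
  prime p -> (0 < k)%N ->
  (2 * p ^ (2 * k) < (2 * k + 2) ^ (3 * k) * primorial p)%N.
Proof.
move=> pp k0; have p0 := prime_gt0 pp.
have [p200|p200] := leqP 200 p; first exact: (primorial_power_bound_large R).
(* In each of the next three ranges [u] is just above the cube root of the upper end, and 2^b is
   below the product of the primes under the lower end. *)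
have [p32|p32] := leqP 32 p.
  have pu : p%:R <= (585 / 100 : R) ^+ 3.
    by have : p%:R <= 200 :> R; [rewrite ler_nat ltnW | lra].
  apply: (primorial_power_bound_pow2 (b := 35) p0 k0 _ pu); [lra | | lra].
  apply: leq_trans (@primorial_ge p [:: 2; 3; 5; 7; 11; 13; 17; 19; 23; 29; 31]%N _ _ _) => //.
    by rewrite !big_cons big_nil; lia.
  by apply/allP => q; rewrite !inE => h; apply: leq_trans p32; lia.
have [p15|p15] := leqP 15 p.
  have pu : p%:R <= (3175 / 1000 : R) ^+ 3.
    by have : p%:R <= 32 :> R; [rewrite ler_nat ltnW | lra].
  apply: (primorial_power_bound_pow2 (b := 14) p0 k0 _ pu); [lra | | lra].
  apply: leq_trans (@primorial_ge p [:: 2; 3; 5; 7; 11; 13]%N _ _ _) => //.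
    by rewrite !big_cons big_nil; lia.
  by apply/allP => q; rewrite !inE => h; apply: leq_trans p15; lia.
have [p8|p8] := leqP 8 p.
  have pu : p%:R <= (2467 / 1000 : R) ^+ 3.
    by have : p%:R <= 15 :> R; [rewrite ler_nat ltnW | lra].
  apply: (primorial_power_bound_pow2 (b := 7) p0 k0 _ pu); [lra | | lra].
  apply: leq_trans (@primorial_ge p [:: 2; 3; 5; 7]%N _ _ _) => //.
    by rewrite !big_cons big_nil; lia.
  by apply/allP => q; rewrite !inE => h; apply: leq_trans p8; lia.
(* For p <= 7 it suffices that p^2 <= 49 < 64 = 4^3 <= (2k + 2)^3. The factor 2 is paid by the
   primorial when p >= 3, and by 2 * 4 < 64 when p = 2. *)
have h1 : ((p ^ 2) ^ k <= 49 ^ k)%N by rewrite leq_exp2r // -[49%N]/(7 ^ 2)%N leq_exp2r.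
have h2 : (64 ^ k <= ((2 * k + 2) ^ 3) ^ k)%N.
  by rewrite leq_exp2r // -[64%N]/(4 ^ 3)%N leq_exp2r //; lia.
have [p3|p3] := leqP 3 p.
  have P2 : (2 <= primorial p)%N.
    apply: leq_trans (@primorial_ge p [:: 2]%N _ _ _) => //=; first by rewrite big_seq1.
    by rewrite p3.
  rewrite !expnM (leq_ltn_trans (leq_mul (leqnn 2) h1)) //.
  rewrite mulnC (leq_trans _ (leq_mul h2 P2)) // ltn_mul2r /= ltn_exp2r //.
have -> : p = 2%N by have := prime_gt1 pp; lia.
rewrite !expnM; apply: leq_trans (_ : 64 ^ k <= _)%N; last first.
  by apply: leq_trans h2 _; rewrite leq_pmulr // primorial_gt0.
apply: (@leq_ltn_trans (2 ^ k * 4 ^ k)); last by rewrite -expnMn ltn_exp2r.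
by rewrite leq_mul // -[X in (X <= _)%N]expn1 leq_exp2l.
Qed.

(** * Coprimality of the two cofactors *)

Lemma dvdz_horner0 (d x : int) (f : {poly int}) :
  (d %| x)%Z -> (d %| (f.[x] - f.[0])%R)%Z.
Proof.
move=> dx; elim/poly_ind: f => [|f c _]; first by rewrite !horner0 subr0 dvdz0.
by rewrite !hornerMXaddC mulr0 add0r addrK dvdz_mull.
Qed.

Definition eval_mx (m : nat) (x : int) (B : 'M[{poly int}]_m) : 'M[int]_m :=
  map_mx (fun f : {poly int} => f.[x]) B.

Lemma adj_eval_mx (m : nat) (x : int) (B : 'M[{poly int}]_m) i j :
  \adj (eval_mx x B) i j = (\adj B i j).[x].
Proof.
by rewrite -[eval_mx x B]/(map_mx (horner_eval x) B) -map_mx_adj mxE.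
Qed.

Lemma eval_loop_mx (n : nat) (M : 'M[int]_n.+2) p e x (i j : 'I_n.+2) :
  eval_mx x (loop_mx M p e n.+1) i j =
  x * \adj M i j + perturbation int p e n.+1 i j.
Proof.
have := @loop_entries n M p e n.+1 i j (leqnn _) (ltn_ord i) (ltn_ord j).
rewrite /entries !inord_val [LHS in _ -> LHS = _]mxE => ->.
rewrite hornerD hornerM hornerX hornerC; congr (_ + _).
by rewrite -(rmorph_perturbation polyC) hornerC.
Qed.

Lemma perturbation_Fp (n p : nat) (e : nat -> nat) i j :
  prime p -> (forall k, (k <= n)%N -> (0 < e k)%N) ->
  perturbation 'F_p p e n.+1 i j = 0.
Proof.
move=> pp e0; have p0 : p%:R = 0 :> 'F_p by rewrite pchar_Fp_0.
rewrite /perturbation p0 !mul0r !add0r.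
case: (boolP ((0 < i)%N && (i <= n.+1)%N)) => [/andP[i0 iN]|_]; last by rewrite mul0r.
by rewrite expr0n eqn0Ngt e0 ?mul0r ?mulr0 // -ltnS prednK.
Qed.

(** Modulo p the perturbation vanishes, so M' M = x det M. Multiplying by adj M' gives det M' M = x
    det M adj M', and p was chosen to divide neither det M nor the corner entry of M. *)
Lemma eval_loop_mx_modp (n : nat) (M : 'M[int]_n.+2) p e x :
  prime p -> (forall k, (k <= n)%N -> (0 < e k)%N) ->
  ~~ (p%:Z %| (M ord_max 0 * \det M)%R)%Z -> ~~ (p%:Z %| x)%Z ->
  ~~ (p%:Z %| (\adj (eval_mx x (loop_mx M p e n.+1)) ord_max 0)%R)%Z /\
  ~~ (p%:Z %| \det (eval_mx x (loop_mx M p e n.+1)))%Z.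
Proof.
move=> pp e0; have chp := pchar_Fp pp; rewrite !(dvdz_pcharf chp).
rewrite rmorphM mulf_eq0 negb_or => /andP[X0 d0] x0.
set M' := eval_mx _ _.
have E : map_mx intr M' = x%:~R *: map_mx intr (\adj M) :> 'M['F_p]_n.+2.
  apply/matrixP => i j; rewrite [LHS]mxE eval_loop_mx rmorphD rmorphM /=.
  by rewrite (rmorph_perturbation intr) perturbation_Fp // addr0 !mxE.
have E1 : map_mx intr M' *m map_mx intr M = (x%:~R * (\det M)%:~R)%:M :> 'M['F_p]_n.+2.
  by rewrite E -scalemxAl -map_mxM mul_adj_mx map_scalar_mx scale_scalar_mx.
have dM' : (\det M')%:~R != 0 :> 'F_p.
  apply/eqP => dM'0; have := congr1 determinant E1.
  rewrite det_mulmx det_map_mx /= dM'0 mul0r det_scalar => /esym/eqP.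
  by rewrite expf_eq0 /= mulf_eq0 (negbTE x0) (negbTE d0).
split=> //; apply/eqP => a0.
have := congr1 (mulmx (map_mx intr (\adj M'))) E1.
rewrite mulmxA -map_mxM mul_adj_mx map_scalar_mx mul_scalar_mx mul_mx_scalar.
move/(congr1 (fun A : 'M['F_p]_n.+2 => A ord_max 0)); rewrite !mxE.
move: a0; rewrite mxE => -> /eqP; rewrite mulr0 mulf_eq0.
by rewrite (negbTE dM') (negbTE X0).
Qed.

Lemma reduced_c_exists (p : nat) (c0 : int) : prime p -> c0 != 0 ->
  exists c, reduced_c p c0 c.
Proof.
move=> pp c00; have [ex|nex] := boolp.EM (exists k, `|c0|%N = p ^ k)%N.
  by exists p.+1; left.
exists (c0 %/ (p ^ logn p `|c0|)%N)%Z; right; split=> //; exists (logn p `|c0|).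
have c0' : (0 < `|c0|)%N by rewrite absz_gt0.
by split=> //; rewrite ?dvdzE /= ?pfactor_dvdn // ltnn.
Qed.

(** Removing the powers of p keeps all other prime divisors. A unit would remain only if |c0| were a
    power of p; then no prime other than p divides [c0], and p + 1 can replace it. *)
Lemma reduced_cP (p : nat) (c0 c : int) : prime p -> c0 != 0 -> reduced_c p c0 c ->
  [/\ (1 < `|c|)%N, ~~ (p%:Z %| c)%Z &
   forall q, prime q -> q != p -> (q%:Z %| c0)%Z -> (q%:Z %| c)%Z].
Proof.
move=> pp c00 [[[k ck] ->]|[npow [k [d1 d2 cE]]]].
  split=> /=; first by rewrite ltnS prime_gt0.
    rewrite dvdzE /= -addn1 dvdn_addr // dvdn1.
    by case: p pp {ck} => [|[]].
  move=> q qq qp; rewrite dvdzE /= ck Euclid_dvdX //.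
  by rewrite dvdn_prime2 // (negbTE qp).
have c0E : c0 = c * (p ^ k)%N%:Z by rewrite cE divzK.
have pc : ~~ (p%:Z %| c)%Z.
  by apply: contra d2 => pc; rewrite expnS c0E PoszM dvdz_mul.
split=> //.
  rewrite ltnNge; apply/negP => c1; apply: npow; exists k.
  have : `|c|%N != 0%N.
    by apply: contra c00; rewrite absz_eq0 c0E => /eqP ->; rewrite mul0r.
  by rewrite c0E abszM /=; case: (`|c|%N) c1 => [|[]] // _ _; rewrite mul1n.
move=> q qq qp; rewrite c0E !dvdzE abszM Euclid_dvdM // => /orP[//|/= h].
by move: h; rewrite Euclid_dvdX // dvdn_prime2 // (negbTE qp).
Qed.

Lemma topleft_full (n : nat) (B : 'M[{poly int}]_n.+2) : topleft n.+2 B = B.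
Proof. by apply/matrixP => i j; rewrite mxE !inord_val. Qed.

Lemma adj_coprime (n : nat) (M : 'M[int]_n.+2) p e c j :
  prime p -> ~~ (p%:Z %| (M ord_max 0 * \det M)%R)%Z -> is_loop_run M p e n.+1 ->
  reduced_c p (detC_adj (loop_mx M p e n.+1)) c -> (0 < j)%N ->
  coprimez (\adj (eval_mx (c ^+ j) (loop_mx M p e n.+1)) ord_max 0)
           (\adj (eval_mx (c ^+ j) (loop_mx M p e n.+1)) ord_max 1).
Proof.
move=> pp pX run redc j0; have p1 := prime_gt1 pp.
set B := loop_mx M p e n.+1 in redc *; set M' := eval_mx _ B.
have e0 k : (k <= n)%N -> (0 < e k)%N by case/(loop_run_bound p1 run).
have c00 : detC_adj B != 0 by have [[_]] := run n (leqnn _); rewrite topleft_full.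
have [c1 pc redq] := reduced_cP pp c00 redc.
set f1 := \adj B ord_max 0; set f2 := \adj B ord_max 1.
(* If both cofactors were constant, [f1] would agree at 0 and 1. At 0 the whole matrix vanishes
   modulo p, hence so does its adjugate; at 1 the entry is nonzero modulo p. *)
have D0 : (0 < maxdeg f1 f2)%N.
  rewrite lt0n; apply/eqP => D0.
  have f1E : f1.[1] = f1.[0].
    rewrite (@size1_polyC _ f1) ?hornerC //.
    by move: D0; rewrite /maxdeg; case: (size f1) => [|[]] //=; lia.
  have [] := eval_loop_mx_modp pp e0 pX (x := 1).
    by rewrite dvdz1 /=; case: p pp {e0 pX run redc c00 B M' c1 pc redq f1 f2 D0 f1E p1} => [|[]].
  rewrite adj_eval_mx -/B -/f1 f1E -adj_eval_mx => /negP[].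
  have chp := pchar_Fp pp; rewrite (dvdz_pcharf chp) -[X in X == 0]/(intr _).
  have z0 : map_mx intr (eval_mx 0 B) = 0 :> 'M['F_p]_n.+2.
    apply/matrixP => i k; rewrite [LHS]mxE eval_loop_mx mul0r add0r mxE.
    by rewrite (rmorph_perturbation intr) perturbation_Fp.
  have := map_mx_adj (intr : int -> 'F_p) (eval_mx 0 B).
  rewrite z0 => /(congr1 (fun A : 'M['F_p]_n.+2 => A ord_max 0)); rewrite mxE => ->.
  rewrite mxE /cofactor (_ : row' _ _ = 0) ?det0 ?mulr0 //.
  by apply/matrixP => i k; rewrite !mxE.
have [u [v uv]] := detC_bezout D0.
have px0 : ~~ (p%:Z %| c ^+ j)%Z.
  by move: pc; rewrite !dvdzE abszX Euclid_dvdX // negb_and => ->.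
have [pA _] := eval_loop_mx_modp pp e0 pX px0.
have AE : \adj M' ord_max 0 = f1.[c ^+ j] by rewrite adj_eval_mx.
have BE : \adj M' ord_max 1 = f2.[c ^+ j] by rewrite adj_eval_mx.
rewrite -/B -/M' AE in pA; rewrite AE BE /coprimez /gcdz; apply/eqP; congr Posz.
set g := gcdn _ _; apply/eqP; apply: contraT => g1.
have g0 : (0 < g)%N.
  rewrite gcdn_gt0 absz_gt0; apply/orP; left.
  by apply: contra pA => /eqP ->; rewrite dvdz0.
have qq : prime (pdiv g) by apply: pdiv_prime; rewrite ltn_neqAle eq_sym g1.
have qA : ((pdiv g)%:Z %| f1.[c ^+ j])%Z by rewrite dvdzE (dvdn_trans (pdiv_dvd g)) ?dvdn_gcdl.
have qB : ((pdiv g)%:Z %| f2.[c ^+ j])%Z by rewrite dvdzE (dvdn_trans (pdiv_dvd g)) ?dvdn_gcdr.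
have qp : pdiv g != p by apply: contraNneq pA => <-.
have qc0 : ((pdiv g)%:Z %| detC_adj B)%Z.
  have := congr1 (fun f => f.[c ^+ j]) uv; rewrite hornerC hornerD !hornerM /detC_adj => <-.
  by rewrite rpredD // dvdz_mulr.
have qx : ((pdiv g)%:Z %| c ^+ j)%Z.
  by move: (redq _ qq qp qc0); rewrite !dvdzE abszX Euclid_dvdX // j0 andbT.
(* The prime divides c^j, so the values of [f2] at c^j and at 0 agree modulo it; the value at 0 is a
   power of p up to sign. *)
have : ((pdiv g)%:Z %| f2.[0])%Z.
  by rewrite -(subKr f2.[c ^+ j] f2.[0]) rpredB // dvdz_horner0.
have [N] := loop_minor2 M p e (ltn0Sn n) (leqnn _); rewrite -/B => f20.
have -> : f2 = (-1) ^+ (1 + n.+1) * lminor (entries B) (bump 1) n.+1.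
  by rewrite -(@adj_topleft n n B 1) topleft_full.
rewrite hornerM f20 dvdzE abszM -polyC1 -polyCN -polyC_exp hornerC abszX.
rewrite abszN exp1n mul1n abszX Euclid_dvdX // natz /= dvdn_prime2 //.
by rewrite (negbTE qp).
Qed.

(** * Norms and fractional parts *)

Lemma lnorm1E (R : realType) n (v : 'cV[R]_n) : lnorm 1%:E v = \sum_i `|v i 0|.
Proof.
rewrite /lnorm invr1 powRr1; last by apply: sumr_ge0 => i _; apply: powR_ge0.
by apply: eq_bigr => i _; rewrite powRr1.
Qed.

Lemma lnorm2E (R : realType) n (v : 'cV[R]_n) :
  lnorm 2%:E v = Num.sqrt (\sum_i v i 0 ^+ 2).
Proof.
rewrite /lnorm powR12_sqrt; last by apply: sumr_ge0 => i _; apply: powR_ge0.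
congr Num.sqrt; apply: eq_bigr => i _.
by rewrite powR_mulrn // real_normK ?num_real.
Qed.

Lemma sum_sqr_ge0 (R : realType) n (v : 'cV[R]_n) : 0 <= \sum_i v i 0 ^+ 2.
Proof. by apply: sumr_ge0 => i _; apply: sqr_ge0. Qed.

Lemma lnorm2_sqr (R : realType) n (v : 'cV[R]_n) :
  lnorm 2%:E v ^+ 2 = \sum_i v i 0 ^+ 2.
Proof. by rewrite lnorm2E sqr_sqrtr // sum_sqr_ge0. Qed.

(** Cauchy-Schwarz: with S the left-hand side, the sum of the squares (b u_i - a v_i)^2 equals
    2ab(ab - S). Vanishing lengths are treated apart to allow division by ab. *)
Lemma sum_mul_le (R : realType) n (u v : 'cV[R]_n) (a b : R) :
  0 <= a -> 0 <= b -> \sum_i u i 0 ^+ 2 = a ^+ 2 -> \sum_i v i 0 ^+ 2 = b ^+ 2 ->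
  \sum_i u i 0 * v i 0 <= a * b.
Proof.
move=> a0 b0 ua vb.
have zero (w : 'cV[R]_n) i : \sum_i w i 0 ^+ 2 = 0 -> w i 0 = 0.
  move=> w0; apply/eqP; rewrite -sqrf_eq0; apply/eqP.
  by apply: (psumr_eq0P _ w0) => // k _; apply: sqr_ge0.
have [a_eq0|a_neq0] := eqVneq a 0.
  rewrite a_eq0 mul0r big1 // => i _; rewrite (zero u) ?mul0r //.
  by rewrite ua a_eq0 expr0n.
have [b_eq0|b_neq0] := eqVneq b 0.
  rewrite b_eq0 mulr0 big1 // => i _; rewrite (zero v) ?mulr0 //.
  by rewrite vb b_eq0 expr0n.
have ab : 0 < a * b by rewrite mulr_gt0 // lt_neqAle eq_sym ?a_neq0 ?b_neq0.
have : 0 <= \sum_i (b * u i 0 - a * v i 0) ^+ 2.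
  by apply: sumr_ge0 => i _; apply: sqr_ge0.
have -> : \sum_i (b * u i 0 - a * v i 0) ^+ 2 =
    \sum_i (b ^+ 2 * u i 0 ^+ 2 + a ^+ 2 * v i 0 ^+ 2 - 2 * a * b * (u i 0 * v i 0)).
  by apply: eq_bigr => i _; move: (u i 0) (v i 0) => x y; ring.
rewrite sumrB big_split /= -3!mulr_sumr ua vb.
move: (\sum_i u i 0 * v i 0) => S h; rewrite -(ler_pM2l ab); lra.
Qed.

Lemma sqrt_le (R : realType) (x a : R) : 0 <= a -> x <= a ^+ 2 -> Num.sqrt x <= a.
Proof. by move=> a0 h; rewrite -(ger0_norm a0) -sqrtr_sqr ler_wsqrtr. Qed.

Lemma sqrt_sum_le (R : realType) n (u v : 'cV[R]_n) (a b : R) :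
  0 <= a -> 0 <= b -> \sum_i u i 0 ^+ 2 = a ^+ 2 -> \sum_i v i 0 ^+ 2 = b ^+ 2 ->
  Num.sqrt (\sum_i (u + v) i 0 ^+ 2) <= a + b.
Proof.
move=> a0 b0 ua vb; have cs := sum_mul_le a0 b0 ua vb.
apply: sqrt_le; first exact: addr_ge0.
have -> : \sum_i (u + v) i 0 ^+ 2 =
    \sum_i (u i 0 ^+ 2 + v i 0 ^+ 2 + 2 * (u i 0 * v i 0)).
  by apply: eq_bigr => i _; rewrite mxE; move: (u i 0) (v i 0) => x y; ring.
rewrite big_split big_split /= -mulr_sumr ua vb.
move: (\sum_i u i 0 * v i 0) cs => S cs; lra.
Qed.

Section LnormTheory.
Context (R : realType) (r : \bar R) (n : nat).
Context (hr : [\/ r = 1%:E, r = 2%:E | r = +oo%E]).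
Implicit Types u v : 'cV[R]_n.

Lemma lnorm_coord v i : `|v i 0| <= lnorm r v.
Proof.
case: hr => ->.
- by rewrite lnorm1E (bigD1 i) //= lerDl sumr_ge0.
- rewrite lnorm2E -sqrtr_sqr ler_wsqrtr // (bigD1 i) //= lerDl sumr_ge0 // => j _.
  exact: sqr_ge0.
- exact: le_bigmax.
Qed.

Lemma lnorm_ge0 v : 0 <= lnorm r v.
Proof.
case: hr => ->; first by rewrite lnorm1E sumr_ge0.
  by rewrite lnorm2E sqrtr_ge0.
by rewrite /lnorm; elim/big_ind: _ => // x y x0 y0; rewrite le_max x0.
Qed.

Lemma lnormZ k v : lnorm r (k *: v) = `|k| * lnorm r v.
Proof.
case: hr => ->.
- by rewrite !lnorm1E mulr_sumr; apply: eq_bigr => i _; rewrite mxE normrM.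
- rewrite !lnorm2E -sqrtr_sqr -sqrtrM ?sqr_ge0 // mulr_sumr.
  by congr Num.sqrt; apply: eq_bigr => i _; rewrite mxE exprMn.
rewrite /lnorm (big_morph ( *%R `|k|) (fun y z => maxr_pMr y z (normr_ge0 k)) (mulr0 _)).
by apply: eq_bigr => i _; rewrite mxE normrM.
Qed.

Lemma lnormN v : lnorm r (- v) = lnorm r v.
Proof. by rewrite -scaleN1r lnormZ normrN1 mul1r. Qed.

Lemma lnormD u v : lnorm r (u + v) <= lnorm r u + lnorm r v.
Proof.
case: hr => E; rewrite E.
- rewrite !lnorm1E -big_split /=; apply: ler_sum => i _.
  by rewrite mxE ler_normD.
- rewrite !lnorm2E; apply: sqrt_sum_le; rewrite ?sqrtr_ge0 ?sqr_sqrtr //.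
    exact: sum_sqr_ge0.
  exact: sum_sqr_ge0.
apply: bigmax_le; first by rewrite -E addr_ge0 ?lnorm_ge0.
by move=> i _; rewrite mxE (le_trans (ler_normD _ _)) // lerD // -E lnorm_coord.
Qed.

Lemma lnorm_le_sum v : lnorm r v <= \sum_i `|v i 0|.
Proof.
case: hr => ->; first by rewrite lnorm1E.
  rewrite lnorm2E; apply: sqrt_le; first exact: sumr_ge0.
  rewrite expr2 mulr_suml; apply: ler_sum => i _.
  rewrite -real_normK ?num_real // expr2 ler_wpM2l // (bigD1 i) //= lerDl.
  exact: sumr_ge0.
apply: bigmax_le; first exact: sumr_ge0.
by move=> i _; rewrite (bigD1 i) //= lerDl sumr_ge0.
Qed.

Lemma lnorm_mulmx (A : 'M[R]_n) (eta : R) v : 0 <= eta ->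
  (forall i j, `|A i j| <= eta) ->
  lnorm r (A *m v) <= n%:R ^+ 2 * eta * lnorm r v.
Proof.
move=> eta0 hA; apply: (le_trans (lnorm_le_sum _)).
have row i : `|(A *m v) i 0| <= n%:R * (eta * lnorm r v).
  rewrite mxE (le_trans (ler_norm_sum _ _ _)) //.
  rewrite mulr_natl -[X in _ *+ X](card_ord n) -sumr_const ler_sum // => j _.
  by rewrite normrM ler_pM // lnorm_coord.
apply: (le_trans (ler_sum _ (fun i _ => row i))).
by rewrite sumr_const card_ord -[X in X <= _]mulr_natl expr2 !mulrA.
Qed.

Lemma lnorm_eq0 v : lnorm r v = 0 -> v = 0.
Proof.
move=> v0; apply/colP => i; rewrite mxE; apply/eqP.
by rewrite -normr_le0 -v0 lnorm_coord.
Qed.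

Lemma lnorm0 : lnorm r (0 : 'cV[R]_n) = 0.
Proof. by rewrite -(scale0r 0) lnormZ normr0 mul0r. Qed.

(** The exponent is 1 for l_1 and l_oo and 2 for l_2; n X^2 is a common bound for the three
    cases. *)
Lemma lnorm_int : exists2 s, (0 < s <= 2)%N & forall v : 'cV[int]_n,
  (exists f : nat, lnorm r (map_mx intr v) ^+ s = f%:R) /\
  forall X : nat, (0 < n)%N -> (0 < X)%N -> (forall i, `|v i 0| <= X%:Z) ->
    lnorm r (map_mx intr v) ^+ s <= n%:R * X%:R ^+ 2.
Proof.
have natP (z : int) : `|z%:~R| = `|z|%N%:R :> R by rewrite natr_absz intr_norm.
have vX (X : nat) (z : int) : `|z| <= X%:Z -> `|z%:~R| <= X%:R :> R.
  by move=> h; rewrite natP ler_nat -lez_nat abszE.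
have XX (X : nat) : (0 < X)%N -> X%:R <= X%:R ^+ 2 :> R.
  by move=> X0; rewrite -natrX ler_nat expnS expn1 leq_pmulr.
case: hr => ->.
- exists 1%N => // v; split=> [|X n0 X0 hv]; rewrite expr1 lnorm1E.
    elim/big_ind: _ => [|_ _ [f ->] [g ->]|i _]; first by exists 0%N.
      by exists (f + g)%N; rewrite natrD.
    by exists `|v i 0%R|%N; rewrite mxE natP.
  rewrite mulr_natl -[X in _ *+ X](card_ord n) -sumr_const; apply: ler_sum => i _.
  by rewrite mxE (le_trans (vX _ _ (hv i))) ?XX.
- exists 2%N => // v; split=> [|X n0 X0 hv]; rewrite lnorm2_sqr.
    elim/big_ind: _ => [|_ _ [f ->] [g ->]|i _]; first by exists 0%N.
      by exists (f + g)%N; rewrite natrD.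
    by exists (`|v i 0%R| ^ 2)%N; rewrite mxE -real_normK ?num_real // natP natrX.
  rewrite mulr_natl -[X in _ *+ X](card_ord n) -sumr_const; apply: ler_sum => i _.
  by rewrite mxE -real_normK ?num_real // ler_pXn2r ?nnegrE ?vX.
exists 1%N => // v; split=> [|X n0 X0 hv]; rewrite expr1.
  rewrite /lnorm; elim/big_ind: _ => [|_ _ [f ->] [g ->]|i _]; first by exists 0%N.
    by case: leP => _; eexists.
  by exists `|v i 0%R|%N; rewrite mxE natP.
apply: bigmax_le; first by rewrite mulr_ge0 ?exprn_ge0.
move=> i _; rewrite mxE (le_trans (vX _ _ (hv i))) // (le_trans (XX _ X0)) //.
by rewrite ler_peMl ?exprn_ge0 // ler1n.
Qed.

End LnormTheory.

(** * Fractional parts and removal of the error factor *)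

Lemma cfracD_int (R : realType) (y : R) (k : int) : cfrac (y + k%:~R) = cfrac y.
Proof.
rewrite /cfrac (_ : _ - 2^-1 = (y - 2^-1) + k%:~R); last by rewrite addrAC.
rewrite (@real_ceilDrz _ (y - 2^-1) k%:~R) ?num_real ?intr_int // intrKceil.
by rewrite rmorphD /= opprD addrACA subrr addr0.
Qed.

(** The second alternative contains the endpoint 1/2, which the last coordinate may reach in the
    Diophantine variant. *)
Lemma cfrac_id (R : realType) (y : R) : `|y| < 2^-1 \/ 0 <= y <= 2^-1 -> cfrac y = y.
Proof.
move=> h; have [y1 y2] : - 2^-1 < y /\ y <= 2^-1.
  by case: h => [|/andP[]]; [rewrite ltr_norml => /andP[]|]; lra.
rewrite /cfrac (@ceil_def _ _ 0) ?subr0 // rmorphB /=; lra.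
Qed.

Lemma cfracvD_int (R : realType) n (y : 'cV[R]_n) (k : 'cV[int]_n) :
  cfracv (y + map_mx intr k) = cfracv y.
Proof. by apply/colP => i; rewrite !mxE cfracD_int. Qed.

Lemma cfracv_int (R : realType) n (y : 'cV[R]_n) :
  exists z : 'cV[int]_n, cfracv y = y - map_mx intr z.
Proof.
exists (\col_i Num.ceil (y i 0 - 2^-1)); apply/colP => i.
by rewrite !mxE.
Qed.

Lemma cfracv_id (R : realType) n (y : 'cV[R]_n) :
  (forall i, `|y i 0| < 2^-1) -> cfracv y = y.
Proof. by move=> h; apply/colP => i; rewrite mxE cfrac_id //; left. Qed.

(* Both sides of the approximate inequality are integers after raising to the
   power [s], so a relative error below [1 / (a ^ 2 F)] disappears. *)
Lemma integrality_gap (R : realType) (a b fu fv s F : nat) (u v K d : R) :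
  (0 < a)%N -> (0 < s <= 2)%N -> 0 <= u -> 0 <= v ->
  u ^+ s = fu%:R -> v ^+ s = fv%:R -> (fv <= F)%N -> (0 < F)%N -> 0 <= d ->
  8 * a%:R ^+ 2 * F%:R * d < K ->
  b%:R * (K - d) * u <= a%:R * (K + d) * v -> b%:R * u <= a%:R * v.
Proof.
move=> a0 s2 u0 v0 us vs fvF F0 d0 hK h.
have a1 : 1 <= a%:R :> R by rewrite ler1n.
have F1 : 1 <= F%:R :> R by rewrite ler1n.
have fF : fv%:R <= F%:R :> R by rewrite ler_nat.
have aF : 1 <= a%:R ^+ 2 * F%:R :> R by rewrite mulr_ege1 // exprn_ege1.
have dK : 8 * d <= 8 * a%:R ^+ 2 * F%:R * d.
  have : d <= a%:R ^+ 2 * F%:R * d by rewrite ler_peMl.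
  by rewrite -!mulrA; lra.
have K0 : 0 < K by lra.
have Kd : 0 < K - d by lra.
have au : 0 <= b%:R * u by rewrite mulr_ge0.
have av : 0 <= a%:R * v by rewrite mulr_ge0.
have s0 : (0 < s)%N by case/andP: s2.
suff H : (b ^ s * fu <= a ^ s * fv)%N.
  rewrite -(@ler_pXn2r _ s) // !exprMn us vs -!natrX -!natrM ler_nat //.
rewrite leqNgt; apply/negP => lt.
have {}lt : a%:R ^+ s * fv%:R + 1 <= b%:R ^+ s * fu%:R :> R.
  by rewrite -!natrX -!natrM natr1 ler_nat.
have {}h : b%:R ^+ s * (K - d) ^+ s * fu%:R <= a%:R ^+ s * (K + d) ^+ s * fv%:R.
  rewrite -us -vs -!exprMn ler_pXn2r // nnegrE.
    by rewrite mulrAC mulr_ge0 // ltW.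
  by rewrite mulrAC mulr_ge0 //; lra.
have h2 : (K - d) ^+ s * (a%:R ^+ s * fv%:R + 1) <= (K + d) ^+ s * (a%:R ^+ s * fv%:R).
  apply: (@le_trans _ _ ((K - d) ^+ s * (b%:R ^+ s * fu%:R))).
    by rewrite ler_pM2l // exprn_gt0.
  by move: h; rewrite mulrA [_ * b%:R ^+ s]mulrC mulrA [(K + d) ^+ s * _]mulrC.
have PL : a%:R ^+ s * fv%:R <= a%:R ^+ 2 * F%:R :> R.
  apply: ler_pM => //.
  by rewrite ler_weXn2l //; case/andP: s2.
have P0 : 0 <= a%:R ^+ s * fv%:R :> R by rewrite mulr_ge0 ?exprn_ge0.
move: (a%:R ^+ s * fv%:R) PL P0 h2 => Q QL Q0 h2.
rewrite -(mulrA 8) in hK; rewrite -(mulrA 8) in dK.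
move: (a%:R ^+ 2 * F%:R) hK aF QL dK => L hL aF QL dK.
have Qd : Q * d <= L * d by rewrite ler_wpM2r.
case: s s2 h2 {us vs lt h s0} => [|[|[|]]] // _.
  rewrite !expr1 => h2; have Ld : d <= L * d by rewrite ler_peMl.
  lra.
move=> h2; have KQd : K * (Q * d) <= K * (L * d) by rewrite ler_pM2l.
have KLd : K * (8 * L * d) < K * K by rewrite ltr_pM2l.
have dd : d * (8 * d) <= d * K by rewrite ler_wpM2l //; lra.
have dK2 : K * (8 * d) <= K * K by rewrite ler_pM2l //; lra.
move: h2; rewrite !sqrrD !sqrrN; nra.
Qed.

Section Sandwich.
Context (R : realType) (r : \bar R) (n : nat).
Context (hr : [\/ r = 1%:E, r = 2%:E | r = +oo%E]).

Lemma lnorm_perturb (K eta : R) (A : 'M[R]_n) (y : 'cV[R]_n) : 0 <= eta ->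
  (forall i j, `|A i j| <= eta) ->
  (`|K| - n%:R ^+ 2 * eta) * lnorm r y <= lnorm r (K *: y + A *m y) /\
  lnorm r (K *: y + A *m y) <= (`|K| + n%:R ^+ 2 * eta) * lnorm r y.
Proof.
move=> eta0 hA; have Ay := lnorm_mulmx hr y eta0 hA.
have Ky := lnormZ hr K y; split.
  have := lnormD hr (K *: y + A *m y) (- (A *m y)).
  by rewrite addrK lnormN // Ky mulrBl; lra.
by have := lnormD hr (K *: y) (A *m y); rewrite Ky mulrDl; lra.
Qed.

End Sandwich.

Lemma root_dim_ge1 (R : realType) (r : \bar R) (n : nat) :
  [\/ r = 1%:E, r = 2%:E | r = +oo%E] -> (0 < n)%N -> 1 <= root_dim r n.
Proof.
move=> hr n0; have n1 : 1 <= n%:R :> R by rewrite ler1n.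
have h (x : R) : 0 <= x -> 1 <= n%:R `^ x.
  by move=> x0; rewrite -[X in X <= _](powRr0 n%:R) ler_powR.
by case: hr => -> //=; apply: h; rewrite invr_ge0.
Qed.

(** * The reduction *)

Definition bezout_vec (n : nat) (b1 b2 : int) : 'cV[int]_n.+2 :=
  \col_i (if i == 0 then b1 else if i == 1 then b2 else 0).

Lemma row_mul_bezout_vec (n : nat) (A : 'M[int]_n.+2) (b1 b2 : int) i :
  \sum_j bezout_vec n b1 b2 j 0 * A i j = b1 * A i 0 + b2 * A i 1.
Proof.
rewrite (bigD1 0) //= (bigD1 1) //= big1 ?addr0 ?mxE // => j /andP[j0 j1].
by rewrite mxE (negbTE j0) (negbTE j1) mul0r.
Qed.

(* Replacing the last column of [M'] by [bezout_vec] gives a matrix of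
   determinant [1], so the vector generates the group [Z^n / M' Z^n]. *)
Lemma bezout_vec_generates (n : nat) (M' : 'M[int]_n.+2) (b1 b2 : int) :
  1 = b1 * \adj M' ord_max 0 + b2 * \adj M' ord_max 1 ->
  forall v : 'cV[int]_n.+2, exists u q, v = M' *m u + q *: bezout_vec n b1 b2.
Proof.
move=> bez v; set w := bezout_vec n b1 b2.
pose N : 'M[int]_n.+2 := \matrix_(i, j) if j == ord_max then w i 0 else M' i j.
have dN : \det N = 1.
  rewrite (expand_det_col _ ord_max) bez -row_mul_bezout_vec; apply: eq_bigr => i _.
  rewrite !mxE eqxx; congr (_ * (_ * \det _)); apply/matrixP => k l.
  by rewrite !mxE eq_sym (negbTE (neq_lift _ _)).
pose z := \adj N *m v.
have vE : v = N *m z by rewrite mulmxA mul_mx_adj dN mul1mx.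
exists (\col_j if j == ord_max then 0 else z j 0), (z ord_max 0).
rewrite {1}vE; apply/colP => i; rewrite !mxE (bigD1 ord_max) //= [in RHS](bigD1 ord_max) //=.
rewrite !mxE !eqxx mulr0 add0r addrC mulrC; congr (_ + _).
by apply: eq_bigr => j jm; rewrite !mxE (negbTE jm).
Qed.

Section Reduction.
Context (R : realType) (r : \bar R) (n : nat).
Context (hr : [\/ r = 1%:E, r = 2%:E | r = +oo%E]).
Context (a b X eta : nat) (M M' A : 'M[int]_n.+2) (K b1 b2 : int).
Context (b0 : (0 < b)%N) (ab : (b <= a)%N) (X0 : (0 < X)%N) (eta0 : (0 < eta)%N).
Context (detM : \det M != 0) (detM' : \det M' != 0).
Context (MX : forall i j, `|M i j| <= X%:Z) (Aeta : forall i j, `|A i j| <= eta%:Z).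
Context (MM' : M *m M' = K%:M + A).
Context (bez : 1 = b1 * \adj M' ord_max 0 + b2 * \adj M' ord_max 1).
Context (Kbig : (8 * a ^ 2 * (n.+2 * X ^ 2) * (n.+2 ^ 2 * eta) < `|K|)%N).

Local Notation toR := (map_mx (intr : int -> R)).
Local Notation x := (target_vec R M' b1 b2).
Local Notation beta := (bezout_vec n b1 b2).
Local Notation nm := (lnorm r).
Let d : R := (\det M')%:~R.
(** [delta] bounds [A] as an operator; [F] below bounds the s-th power of the length of the first
    column of [M]. *)
Let delta : R := n.+2%:R ^+ 2 * eta%:R.
Let alpha : R := a%:R / b%:R.
Let F : nat := (n.+2 * X ^ 2)%N.

Lemma det_neq0_R : d != 0. Proof. by rewrite intr_eq0. Qed.

Lemma M'_unit : toR M' \in unitmx.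
Proof. by rewrite unitmxE det_map_mx unitfE det_neq0_R. Qed.

Lemma target_vecE : toR M' *m x = toR beta.
Proof.
rewrite /target_vec mulmxA mulmxV ?M'_unit // mul1mx; apply/colP => i.
by rewrite !mxE; case: ifP => // _; case: ifP.
Qed.

Lemma scale_target_vec : d *: x = toR (\adj M' *m beta).
Proof.
by rewrite map_mxM -target_vecE mulmxA -map_mxM mul_adj_mx map_scalar_mx mul_scalar_mx.
Qed.

Lemma last_target_vec : d * x ord_max 0 = 1.
Proof.
have := congr1 (fun v : 'cV[R]_n.+2 => v ord_max 0) scale_target_vec.
rewrite mxE => ->; rewrite mxE mxE (eq_bigr (fun j => beta j 0 * \adj M' ord_max j)).
  by rewrite row_mul_bezout_vec -bez.
by move=> j _; rewrite mulrC.
Qed.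

Lemma real_MM' (y : 'cV[R]_n.+2) : toR M *m (toR M' *m y) = K%:~R *: y + toR A *m y.
Proof. by rewrite mulmxA -map_mxM MM' map_mxD mulmxDl map_scalar_mx mul_scalar_mx. Qed.

Lemma K_gt : 8 * a%:R ^+ 2 * F%:R * delta < `|K%:~R| :> R.
Proof. by rewrite -intr_norm -abszE /delta -!natrX -!natrM ltr_nat. Qed.

Lemma delta_ge1 : 1 <= delta.
Proof. by rewrite /delta -natrX -natrM ler1n muln_gt0 eta0 expn_gt0. Qed.

Lemma aF_ge1 : (1 <= a%:R :> R) * (1 <= F%:R :> R).
Proof.
by rewrite !ler1n (leq_trans b0 ab) /F muln_gt0 expn_gt0 X0.
Qed.

(** One of the eight parts of the lower bound on |K| pays for [delta]. The rest makes the preimage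
    of a shortest vector small enough to be its own fractional part. *)
Lemma K_delta : 7 * a%:R * F%:R < `|K%:~R| - delta :> R.
Proof.
have [a1 F1] := aF_ge1; have := K_gt; have := delta_ge1 => d1.
have aa : a%:R <= a%:R ^+ 2 :> R by rewrite ler_eXnr.
have h1 : a%:R * F%:R <= a%:R ^+ 2 * F%:R :> R by rewrite ler_pM2r //; lra.
have h2 : 1 <= a%:R * F%:R :> R by rewrite mulr_ege1.
have : (a%:R ^+ 2 * F%:R) * 1 <= (a%:R ^+ 2 * F%:R) * delta by rewrite ler_pM2l //; lra.
have : 1 * delta <= (a%:R ^+ 2 * F%:R) * delta by rewrite ler_pM2r //; lra.
rewrite -!mulrA; lra.
Qed.

Lemma nm_MM' (y : 'cV[R]_n.+2) :
  (`|K%:~R| - delta) * nm y <= nm (toR M *m (toR M' *m y)) /\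
  nm (toR M *m (toR M' *m y)) <= (`|K%:~R| + delta) * nm y.
Proof.
rewrite real_MM'; apply: lnorm_perturb => // i j.
rewrite mxE -intr_norm -[eta%:R]/(eta%:Z%:~R) ler_int //; exact: Aeta.
Qed.

Lemma cfracv_mul (q : int) : exists qv : 'cV[int]_n.+2,
  toR qv = toR M' *m cfracv (q%:~R *: x).
Proof.
have [z ->] := cfracv_int (q%:~R *: x).
exists (q *: beta - M' *m z).
by rewrite mulmxBr -scalemxAr target_vecE map_mxB map_mxZ map_mxM.
Qed.

Lemma M_inj (v : 'cV[int]_n.+2) : M *m v = 0 -> v = 0.
Proof.
move=> Mv; have := congr1 (mulmx (\adj M)) Mv.
rewrite mulmxA mul_adj_mx mulmx0 mul_scalar_mx => /colP h; apply/colP => i.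
by have := h i; rewrite !mxE => /eqP; rewrite mulf_eq0 (negbTE detM) => /eqP.
Qed.

Lemma toR_eq0 (v : 'cV[int]_n.+2) : toR v = 0 -> v = 0.
Proof.
move=> /colP h; apply/colP => i; have := h i; rewrite !mxE => /eqP.
by rewrite intr_eq0 => /eqP.
Qed.

(** The minimum is attained because s-th powers of lengths are natural numbers; comparison with the
    first column of [M] bounds it by [F]. *)
Lemma shortest_vector s : (0 < s <= 2)%N ->
  (forall v : 'cV[int]_n.+2,
    (exists f : nat, nm (toR v) ^+ s = f%:R) /\
    forall X : nat, (0 < n.+2)%N -> (0 < X)%N -> (forall i, `|v i 0| <= X%:Z) ->
      nm (toR v) ^+ s <= n.+2%:R * X%:R ^+ 2) ->
  exists q : 'cV[int]_n.+2, exists2 f : nat,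
    [/\ q != 0, nm (toR M *m toR q) ^+ s = f%:R & (f <= F)%N] &
    forall q' : 'cV[int]_n.+2, q' != 0 ->
      nm (toR M *m toR q) <= nm (toR M *m toR q').
Proof.
move=> s2 intP; have s0 : (0 < s)%N by case/andP: s2.
pose P f := exists2 q : 'cV[int]_n.+2, q != 0 & nm (toR M *m toR q) ^+ s = f%:R.
have exP (q : 'cV[int]_n.+2) : q != 0 -> exists2 f : nat,
    nm (toR M *m toR q) ^+ s = f%:R & P f.
  move=> q0; have [[f fE] _] := intP (M *m q); rewrite map_mxM in fE.
  by exists f => //; exists q.
pose q1 : 'cV[int]_n.+2 := delta_mx 0 0.
have q10 : q1 != 0.
  apply/eqP => /colP/(_ 0); rewrite !mxE /= => /eqP; by rewrite oner_eq0.
have [f1 f1E Pf1] := exP q1 q10.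
have f1F : (f1 <= F)%N.
  rewrite -(ler_nat R) -f1E -map_mxM /F natrM natrX.
  have [_] := intP (M *m q1); apply => // i.
  by rewrite -colE mxE.
have [f [[q q0 fE] fmin]] := exists_least (ex_intro P f1 Pf1).
exists q, f; first by split=> //; apply: leq_trans (fmin _ Pf1) f1F.
move=> q' q'0; have [f' f'E Pf'] := exP q' q'0.
rewrite -(@ler_pXn2r _ s) ?nnegrE ?lnorm_ge0 // fE f'E ler_nat.
exact: fmin.
Qed.

Lemma vector_as_multiple (q : 'cV[int]_n.+2) :
  exists u t, invmx (toR M') *m toR q = toR u + t%:~R *: x.
Proof.
have [u [t qE]] := bezout_vec_generates bez q; exists u, t.
rewrite qE map_mxD map_mxM map_mxZ mulmxDr mulKmx ?M'_unit //.
by rewrite -scalemxAr -target_vecE mulKmx ?M'_unit.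
Qed.

(** The two-sided estimate [nm_MM'] turns the bound on y against y' into one on lengths, up to the
    factor (K + delta) / (K - delta), which [integrality_gap] removes. *)
Lemma short_vector_of_close (s f : nat) (q qv : 'cV[int]_n.+2) (y y' : 'cV[R]_n.+2) :
  (0 < s <= 2)%N ->
  (exists f : nat, nm (toR (M *m qv)) ^+ s = f%:R) ->
  q != 0 -> nm (toR M *m toR q) ^+ s = f%:R -> (f <= F)%N ->
  (forall q' : 'cV[int]_n.+2, q' != 0 ->
      nm (toR M *m toR q) <= nm (toR M *m toR q')) ->
  toR q = toR M' *m y' -> toR qv = toR M' *m y ->
  0 < nm y -> nm y <= alpha * nm y' ->
  short_vector r alpha (toR M) qv.
Proof.
move=> s2 [fv fvE] q0 fE fF qmin qE qvE y0 yy'.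
have KdF := K_delta; have [a1 F1] := aF_ge1; have d1 := delta_ge1.
have bR : 0 < b%:R :> R by rewrite ltr0n.
have Kd : 0 < `|K%:~R| - delta :> R.
  by apply: le_lt_trans KdF; rewrite !mulr_ge0.
have [lo' _] := nm_MM' y'; have [lo hi] := nm_MM' y.
rewrite -qE in lo'; rewrite -qvE in lo hi.
have len_gt0 (w : 'cV[int]_n.+2) : w != 0 -> 0 < nm (toR M *m toR w).
  move=> w0; rewrite lt_neqAle lnorm_ge0 // andbT eq_sym; apply/eqP => h.
  move/eqP: w0; apply; apply: M_inj; apply: toR_eq0; rewrite map_mxM.
  exact: (lnorm_eq0 hr h).
exists (nm (toR M *m toR q)); first split.
- by split; [exists q | apply/eqP; rewrite gt_eqF ?len_gt0].
- move=> _ [[q' _ <-] q'0]; apply: qmin; apply/eqP => q'E; apply: q'0.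
  by rewrite /= q'E map_mx0 mulmx0 lnorm0.
apply/andP; split; first by apply: lt_le_trans lo; rewrite mulr_gt0.
rewrite /alpha mulrAC ler_pdivlMr // mulrC.
have a0 : (0 < a)%N := leq_trans b0 ab.
have F0 : (0 < F)%N by rewrite -(ltr0n R); lra.
apply: (@integrality_gap R a b fv f s F _ _ `|K%:~R| delta) => //; rewrite ?lnorm_ge0 //.
- by rewrite -map_mxM.
- lra.
- exact: K_gt.
have by' : b%:R * nm y <= a%:R * nm y'.
  by move: yy'; rewrite /alpha mulrAC ler_pdivlMr // mulrC.
apply: (@le_trans _ _ (b%:R * (`|K%:~R| - delta) * ((`|K%:~R| + delta) * nm y))).
  by rewrite ler_pM2l // mulr_gt0.
have Kp : 0 <= (`|K%:~R| + delta : R) by rewrite addr_ge0 //; lra.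
have Km : 0 <= (`|K%:~R| - delta : R) by lra.
have h1 := ler_wpM2l (mulr_ge0 Km Kp) by'.
have h2 := ler_wpM2l (mulr_ge0 (ler0n R a) Kp) lo'.
move: (`|K%:~R| - delta) (`|K%:~R| + delta) h1 h2 => km kp h1 h2.
move: (nm y) (nm y') (nm (toR M *m toR q)) h1 h2 => Y Y' V h1 h2; lra.
Qed.

Lemma reduction_correct (q0 : int) :
  simultaneous_approx r alpha x q0 \/
  good_diophantine_approx r (alpha / root_dim r n.+2) x
    (root_dim r n.+2 * d / (2 * alpha)) q0 ->
  exists2 qv : 'cV[int]_n.+2,
    toR qv = toR M' *m cfracv (q0%:~R *: x) & short_vector r alpha (toR M) qv.
Proof.
move=> approx; have [s s2 intP] := lnorm_int n.+2 hr.
have s0 : (0 < s)%N by case/andP: s2.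
have [q [f [qn0 fE fF] qmin]] := shortest_vector s2 intP.
have [qv qvE] := cfracv_mul q0.
pose y' : 'cV[R]_n.+2 := invmx (toR M') *m toR q.
have qE : toR q = toR M' *m y' by rewrite mulKVmx ?M'_unit.
exists qv => //.
have KdF := K_delta; have [a1 F1] := aF_ge1; have d1 := delta_ge1.
have bR : 1 <= b%:R :> R by rewrite ler1n.
have aR : b%:R <= a%:R :> R by rewrite ler_nat.
have alpha0 : 0 < alpha by rewrite /alpha divr_gt0 //; lra.
have alpha_a : alpha <= a%:R by rewrite /alpha ler_pdivrMr ?ler_peMr //; lra.
have nmq : nm (toR M *m toR q) <= F%:R.
  have [le1|/ltW ge1] := leP (nm (toR M *m toR q)) 1; first by lra.
  apply: (@le_trans _ _ (nm (toR M *m toR q) ^+ s)); first by rewrite ler_eXnr.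
  by rewrite fE ler_nat.
have [lo' _] := nm_MM' y'; rewrite -qE in lo'.
(* Here 7 a F |y'| <= |M q| <= F, so y' lies strictly inside the unit cube centred at 0. *)
have small : 2 * a%:R * nm y' < 1.
  have y'0 := lnorm_ge0 hr y'.
  have h : 7 * a%:R * F%:R * nm y' <= F%:R.
    apply: le_trans (le_trans lo' nmq); apply: ler_wpM2r => //; exact: ltW.
  have h7 : 7 * a%:R * nm y' <= 1.
    rewrite -(@ler_pM2r _ F%:R); last lra.
    by rewrite mul1r mulrAC.
  have ay : 0 <= a%:R * nm y' by rewrite mulr_ge0.
  move: h7; rewrite -!mulrA; lra.
have y'n0 : y' != 0.
  apply: contra qn0 => /eqP y'0; apply/eqP; apply: toR_eq0.
  by rewrite qE y'0 mulmx0.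
have y'gt0 : 0 < nm y'.
  rewrite lt_neqAle lnorm_ge0 // andbT eq_sym; apply/eqP => h.
  by case/negP: y'n0; apply/eqP; apply: (lnorm_eq0 hr h).
have half i : `|y' i 0| < 2^-1.
  apply: (le_lt_trans (lnorm_coord hr y' i)).
  have : 1 * nm y' <= a%:R * nm y' by rewrite ler_pM2r.
  by move: small; rewrite -!mulrA; lra.
have y'id := cfracv_id half.
have [u [t y'E]] := vector_as_multiple q; rewrite -/y' in y'E.
have dist_t : cfracv (t%:~R *: x) = y'.
  by rewrite -y'id y'E addrC cfracvD_int.
suff [Y0 Yy'] : 0 < nm (cfracv (q0%:~R *: x)) /\
    nm (cfracv (q0%:~R *: x)) <= alpha * nm y'.
  apply: (short_vector_of_close s2 _ qn0 fE fF qmin qE qvE Y0 Yy').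
  by have [] := intP (M *m qv).
case: approx => [[mu [_ mumin] /andP[Y0 Ymu]]|].
  split=> //; apply: le_trans Ymu _; rewrite ler_pM2l //; apply: mumin.
  split; first by exists t; rewrite // dist_t.
  by apply/eqP; rewrite gt_eqF.
have root1 := root_dim_ge1 hr (ltn0Sn n.+1).
case=> [/andP[q01 q02] [mu [[q1 _ muE] mumin] Ymu]].
(* The range for [q0] ends at det M' / 2, so the last coordinate q0 / det M' lies in (0, 1/2] and
   survives reduction modulo 1: the distance is not zero. *)
have NE : alpha / root_dim r n.+2 * (root_dim r n.+2 * d / (2 * alpha)) = d / 2.
  by field; rewrite !gt_eqF //; lra.
rewrite NE real_floor_ge_int ?num_real // in q02.
have q0R : 1 <= q0%:~R :> R by rewrite (ler_int R 1).
(* A positive [q0] bounded by det M' / 2 forces det M' to be positive. *)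
have d_gt0 : 0 < d by lra.
have x_last : x ord_max 0 = d^-1.
  apply: (mulfI det_neq0_R); rewrite last_target_vec mulfV ?det_neq0_R //.
split.
  apply: lt_le_trans (lnorm_coord hr _ ord_max); rewrite mxE mxE x_last.
  have q0d : q0%:~R / d <= 2^-1 by rewrite ler_pdivrMr //; lra.
  have q0d0 : 0 < q0%:~R / d by rewrite divr_gt0 //; lra.
  by rewrite cfrac_id ?gtr0_norm //; right; rewrite q0d ltW.
(* The multiplier [t] matters only modulo det M'; this representative satisfies t' = det M' y'_last,
   so it inherits the smallness of y'. *)
pose t' : int := t + \det M' * u ord_max 0.
have t'E : t'%:~R = d * y' ord_max 0.
  rewrite y'E mxE [toR u _ _]mxE [(_ *: x) _ _]mxE x_last mulrDr mulrCA.
  rewrite mulfV ?det_neq0_R // mulr1 addrC.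
  by rewrite /t' rmorphD rmorphM.
have t'x : t'%:~R *: x = t%:~R *: x + toR (u ord_max 0 *: (\adj M' *m beta)).
  rewrite map_mxZ -scale_target_vec scalerA -scalerDl; congr (_ *: _).
  by rewrite /t' rmorphD rmorphM /= mulrC.
have dist_t' : cfracv (t'%:~R *: x) = y' by rewrite t'x cfracvD_int.
(* The range requires a positive multiplier. The sign may be changed since the coordinates of y' are
   strictly below 1/2 in absolute value. *)
have dist_abs : nm (cfracv (`|t'|%:~R *: x)) = nm y'.
  have [t'0|t'0] := leP 0 t'; first by rewrite ger0_norm // dist_t'.
  rewrite ltr0_norm // rmorphN scaleNr; have [z zE] := cfracv_int (t'%:~R *: x).
  rewrite dist_t' in zE.
  have -> : t'%:~R *: x = y' + toR z by rewrite zE subrK.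
  rewrite opprD -map_mxN cfracvD_int cfracv_id ?lnormN // => i.
  by rewrite mxE normrN.
have t'1 : 1 <= `|t'|.
  have t'n0 : t' != 0.
    apply: contra y'n0 => /eqP t'0; rewrite -dist_t' t'0 scale0r; apply/eqP.
    by apply/colP => i; rewrite !mxE cfrac_id //; left; rewrite normr0 invr_gt0.
  by rewrite -gtz0_ge1 normr_gt0.
have t'N : `|t'| <= Num.floor (root_dim r n.+2 * d / (2 * alpha)).
  rewrite real_floor_ge_int ?num_real // intr_norm t'E normrM gtr0_norm //.
  apply: (@le_trans _ _ (d * nm y')); first by rewrite ler_pM2l // lnorm_coord.
  have h : 2 * alpha * nm y' <= root_dim r n.+2.
    have : alpha * nm y' <= a%:R * nm y' by rewrite ler_pM2r.
    by move: small; rewrite -!mulrA; lra.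
  rewrite ler_pdivlMr; last by rewrite mulr_gt0.
  by rewrite -mulrA [nm y' * _]mulrC [root_dim _ _ * d]mulrC ler_pM2l.
have mu0 : 0 <= mu by rewrite -muE lnorm_ge0.
have muy' : mu <= nm y'.
  by rewrite -dist_abs; apply: mumin; exists `|t'| => //; apply/andP.
apply: le_trans Ymu _; rewrite -mulrA ler_pM2l //; apply: le_trans muy'.
by rewrite mulrC ler_pdivrMr ?ler_peMr //; lra.
Qed.

End Reduction.

(** * Sizes of the parameters *)

Lemma max_entry_bound (n : nat) (M : 'M[int]_n.+2) :
  M ord_max 0 = \big[Num.max/0]_i \big[Num.max/0]_j `|M i j| ->
  forall i j, `|M i j| <= M ord_max 0.
Proof.
move=> -> i j; apply: le_trans (le_bigmax _ (fun i => \big[Num.max/0]_j `|M i j|) i).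
exact: (le_bigmax _ (fun j => `|M i j|)).
Qed.

Lemma max_entry_gt0 (n : nat) (M : 'M[int]_n.+2) : \det M != 0 ->
  (forall i j, `|M i j| <= M ord_max 0) -> 0 < M ord_max 0.
Proof.
move=> dM hM; rewrite lt_neqAle (le_trans (normr_ge0 _) (hM ord_max 0)) andbT.
apply: contra dM => /eqP X0; rewrite (_ : M = 0) ?det0 //.
by apply/matrixP => i j; apply/eqP; rewrite mxE -normr_le0 X0.
Qed.

(** A column contains one diagonal p, at most n + 1 further copies of p when it is the first, and at
    most one power of p, with exponent at most 2n + 2. *)
Lemma perturbation_col_bound (n p : nat) (e : nat -> nat) (j : 'I_n.+2) :
  (0 < p)%N -> (forall k, (k <= n)%N -> (e k <= k.*2.+2)%N) ->
  \sum_(k < n.+2) `|perturbation int p e n.+1 k j| <=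
  (n.+2 * p + p ^ n.*2.+2)%N%:Z.
Proof.
move=> p0 eb.
have le1 (k : 'I_n.+2) : `|perturbation int p e n.+1 k j| <=
    ((p * (k == j) + p * (0 < k)%N) + p ^ n.*2.+2 * (k == j.+1 :> nat))%N%:Z.
  rewrite /perturbation -!natrX -!natrM -!natrD -!natrM -natrD ger0_norm ?ler0n //.
  rewrite natz lez_nat -addnA leq_add2l.
  have [k0|k0] := posnP k; first by rewrite k0.
  rewrite -[(k <= n.+1)%N]/(k < n.+2)%N ltn_ord /= mul1n muln1; apply: leq_add.
    by rewrite -[X in (_ <= X)%N]muln1 leq_mul2l leq_b1 orbT.
  have -> : (k == j.+1 :> nat) = (j == k.-1 :> nat) by lia.
  rewrite leq_mul2r; case: eqP => //= kj; rewrite leq_pexp2l //.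
  have kn : (k.-1 <= n)%N by rewrite -ltnS prednK // -ltnS ltn_ord.
  by apply: leq_trans (eb _ kn) _; rewrite !ltnS leq_double.
apply: le_trans (ler_sum _ (fun k _ => le1 k)) _.
rewrite -natz -(big_morph Posz PoszD (erefl _)) natz lez_nat !big_split /=.
apply: leq_add.
  rewrite -!big_distrr /= -mulnDr mulnC leq_mul2r; apply/orP; right.
  rewrite (bigD1 j) //= eqxx big1 ?addn0 => [|k kj]; last by rewrite (negbTE kj).
  rewrite big_ord_recl /= add0n.
  by rewrite (eq_bigr (fun=> 1%N)) // sum1_card card_ord.
rewrite -big_distrr /= -[X in (_ <= X)%N]muln1 leq_mul2l; apply/orP; right.
have [jn|jn] := ltnP j.+1 n.+2; last first.
  by rewrite big1 // => k _; rewrite ltn_eqF // (leq_trans (ltn_ord k)).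
rewrite (bigD1 (Ordinal jn)) //= eqxx big1 // => k kj.
by apply/eqP; rewrite eqb0; apply: contra kj => /eqP kj; apply/eqP/val_inj.
Qed.

Lemma error_entry_bound (n p X : nat) (e : nat -> nat) (M : 'M[int]_n.+2)
    (i j : 'I_n.+2) :
  (0 < p)%N -> (forall k, (k <= n)%N -> (e k <= k.*2.+2)%N) ->
  (forall i j, `|M i j| <= X%:Z) ->
  `|(M *m \matrix_(i < n.+2, j < n.+2) perturbation int p e n.+1 i j) i j| <=
  (X * (n.+2 * p + p ^ n.*2.+2))%N%:Z.
Proof.
move=> p0 eb MX; rewrite mxE; apply: le_trans (ler_norm_sum _ _ _) _.
apply: (@le_trans _ _ (\sum_(k < n.+2) X%:Z * `|perturbation int p e n.+1 k j|)).
  by apply: ler_sum => k _; rewrite mxE normrM ler_wpM2r.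
by rewrite -mulr_sumr PoszM ler_wpM2l // perturbation_col_bound.
Qed.

(** Put m = n + 2. The primorial estimate with k = m - 1 bounds 2 p^(2m - 2) by (2m)^(3m - 3) X D.
    Together with 8 m^3 X^3 this makes (2m)^(3m) X^4 D, and X^4 <= X^(3m). *)
Lemma parameter_bound (R : realType) (n p X D a C : nat) :
  prime p -> (0 < X)%N -> (0 < D)%N -> (0 < a)%N -> (primorial p <= X * D)%N ->
  (a ^ 2 * (2 * X * n.+2) ^ (3 * n.+2) <= C)%N ->
  (8 * a ^ 2 * (n.+2 * X ^ 2) * (n.+2 ^ 2 * (X * (n.+2 * p + p ^ n.*2.+2))) < C * D)%N.
Proof.
move=> pp X0 D0 a0 PXD aC; have p1 := prime_gt1 pp; have p0 := prime_gt0 pp.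
set m := n.+2; have key := primorial_power_bound_all R pp (ltn0Sn n).
have E : (2 * n.+1 = n.*2.+2)%N by rewrite mul2n.
have E2 : (2 * n.+1 + 2 = 2 * m)%N by rewrite /m; lia.
rewrite E2 E in key.
have mp : (m * p + p ^ n.*2.+2 <= 2 * p ^ n.*2.+2)%N.
  rewrite mulSn mul1n leq_add2r expnS mulnC leq_mul2l; apply/orP; right.
  apply: (@leq_trans (2 ^ n.*2.+1)); last by rewrite leq_exp2r.
  by apply: leq_trans (ltn_expl n.*2.+1 (ltnSn 1)); rewrite /m; lia.
apply: (@leq_ltn_trans (a ^ 2 * (8 * m ^ 3 * X ^ 3) * (2 * p ^ n.*2.+2))%N).
  have -> : (8 * a ^ 2 * (m * X ^ 2) * (m ^ 2 * (X * (m * p + p ^ n.*2.+2))) =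
     a ^ 2 * (8 * m ^ 3 * X ^ 3) * (m * p + p ^ n.*2.+2))%N.
    by rewrite !expnS !expn0; move: (p ^ _)%N => z; ring.
  by rewrite leq_mul2l mp orbT.
apply: (@leq_trans (a ^ 2 * (8 * m ^ 3 * X ^ 3) * ((2 * m) ^ (3 * n.+1) * (X * D)))%N).
  rewrite ltn_pmul2l ?muln_gt0 ?expn_gt0 ?a0 ?X0 //.
  by apply: leq_trans key _; rewrite leq_mul2l PXD orbT.
apply: (@leq_trans (a ^ 2 * (2 * X * m) ^ (3 * m) * D)%N); last by rewrite leq_mul2r aC orbT.
have -> : (a ^ 2 * (8 * m ^ 3 * X ^ 3) * ((2 * m) ^ (3 * n.+1) * (X * D)) =
   a ^ 2 * ((2 * m) ^ (3 * m) * X ^ 4) * D)%N.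
  rewrite [in RHS](_ : (3 * m = 3 + 3 * n.+1)%N); last by rewrite /m; lia.
  rewrite expnD !expnMn; move: (m ^ (3 * n.+1))%N (2 ^ (3 * n.+1))%N => z w.
  by rewrite !expnS !expn0; ring.
rewrite leq_mul2r leq_mul2l; apply/orP; right; apply/orP; right.
rewrite -mulnA (mulnC X) mulnA [X in (_ <= X)%N]expnMn leq_mul2l leq_pexp2l ?orbT //.
by rewrite /m; lia.
Qed.

Lemma size_boundE (R : realType) (n a X : nat) (M : 'M[int]_n.+2) :
  M ord_max 0 = X%:Z ->
  size_bound R a M = (a ^ 2 * (2 * X * n.+2) ^ (3 * n.+2))%N%:R.
Proof. by move=> XE; rewrite /size_bound XE natrM !natrX !natrM. Qed.

Lemma ln_ratio_gt0 (R : realType) (S c : nat) : (1 < S)%N -> (1 < c)%N ->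
  0 < ln (S%:R : R) / ln (c%:R : R).
Proof. by move=> S1 c1; rewrite divr_gt0 // ln_gt0 // ltr1n. Qed.

Lemma ceil_log_bound (R : realType) (S c j : nat) : (1 < S)%N -> (1 < c)%N ->
  j%:Z = Num.ceil (ln (S%:R : R) / ln (c%:R : R)) -> (0 < j)%N /\ (S <= c ^ j)%N.
Proof.
move=> S1 c1 jE; have c0 := ltnW c1; have S0 := ltnW S1.
have lc : 0 < ln (c%:R : R) by rewrite ln_gt0 // ltr1n.
have h := ln_ratio_gt0 R S1 c1; split.
  by rewrite -ltz_nat jE ceil_gt0.
rewrite -(ler_nat R) natrX -ler_ln ?posrE ?exprn_gt0 ?ltr0n // lnXn ?ltr0n //.
rewrite -[ln c%:R *+ j]mulr_natl -ler_pdivrMr // -[j%:R]/(j%:Z%:~R) jE.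
exact: real_ceil_ge (num_real _).
Qed.

(** * Existence of an execution and conclusion *)

Lemma min_bezout_exists (A B : int) : coprimez A B -> exists b1 b2, min_bezout A B b1 b2.
Proof.
case/coprimezP => -[u v] /= uv.
have [|m [[b1 [b2 [b12 b1m]]] mmin]] := @exists_least
    (fun k => exists b1 b2, 1 = b1 * A + b2 * B /\ `|b1|%N = k).
  by exists `|u|%N, u, v.
exists b1, b2; split=> // b1' b2' h; rewrite -!abszE lez_nat b1m.
by apply: mmin; exists b1', b2'.
Qed.

Lemma least_prime_exists (N : int) : N != 0 ->
  exists p, is_least (fun q => prime q /\ ~~ (q%:Z %| N)%Z) p.
Proof.
move=> N0; apply: exists_least; have [q qN qp] := prime_above `|N|.
exists q; split=> //; rewrite dvdzE gtnNdvd // absz_gt0 //.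
Qed.

Lemma size_bound_gt1 (n a X : nat) : (0 < a)%N -> (0 < X)%N ->
  (1 < a ^ 2 * (2 * X * n.+2) ^ (3 * n.+2))%N.
Proof.
move=> a0 X0; apply: (@leq_trans (2 * X * n.+2)); first by nia.
rewrite -[X in (X <= _)%N]mul1n -[X in (_ * X <= _)%N]expn1 leq_mul ?expn_gt0 ?a0 //.
by rewrite leq_pexp2l // !muln_gt0 X0.
Qed.

Lemma run_exists (R : realType) (n a X : nat) (M : 'M[int]_n.+2) :
  \det M != 0 -> (0 < a)%N -> (0 < X)%N -> M ord_max 0 = X%:Z ->
  exists p e c j M' b1 b2, run R a M p e c j M' b1 b2.
Proof.
move=> dM a0 X0 XE.
have XD0 : M ord_max 0 * \det M != 0 by rewrite mulf_neq0 // XE; lia.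
have [p pleast] := least_prime_exists XD0; have [[pp pXD] _] := pleast.
have [e erun] := exists_loop_run M (prime_gt1 pp).
have c00 : detC_adj (loop_mx M p e n.+1) != 0.
  by have [[_]] := erun n (ltnSn n); rewrite topleft_full.
have [c redc] := reduced_c_exists pp c00.
have [c1 pc _] := reduced_cP pp c00 redc.
have S1 := size_bound_gt1 n a0 X0.
pose j := `|Num.ceil (ln (size_bound R a M) / ln (`|c|%:~R : R))|%N.
have jE : j%:Z = Num.ceil (ln (size_bound R a M) / ln (`|c|%:~R : R)).
  rewrite gez0_abs // ltW // ceil_gt0 (size_boundE R a XE) -abszE.
  exact: ln_ratio_gt0.
have jE' := jE; rewrite (size_boundE R a XE) -abszE in jE'.
have [j0 _] := ceil_log_bound S1 c1 jE'.
have cop := adj_coprime pp pXD erun redc j0.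
have [b1 [b2 bmin]] := min_bezout_exists cop.
have e0 k : (k <= n)%N -> (0 < e k)%N by case/(loop_run_bound (prime_gt1 pp) erun).
have px : ~~ (p%:Z %| c ^+ j)%Z.
  by move: pc; rewrite !dvdzE abszX Euclid_dvdX // negb_and => ->.
(* The determinant of M' is nonzero because it is nonzero modulo p. *)
have [_ pd] := eval_loop_mx_modp pp e0 pXD px.
exists p, e, c, j, (eval_mx (c ^+ j) (loop_mx M p e n.+1)), b1, b2; split=> //.
by apply: contraNneq pd => ->; rewrite dvdz0.
Qed.

(* The dimension is n.+2. *)
Theorem theorem4p7 (R : realType) (r : \bar R)
  (hr : [\/ r = 1%:E, r = 2%:E | r = +oo%E])
  (n : nat) (a b : nat) (hb : (0 < b)%N) (hab : (b <= a)%N)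
  (M : 'M[int]_n.+2) (hdet : \det M != 0)
  (hmax : M ord_max 0 = \big[Num.max/0]_i \big[Num.max/0]_j `|M i j|) :
  let alpha : R := a%:R / b%:R in
  (exists p e c j M' b1 b2, run R a M p e c j M' b1 b2) /\
  (forall p e c j M' b1 b2, run R a M p e c j M' b1 b2 ->
   let x := target_vec R M' b1 b2 in
   let N := root_dim r n.+2 * (\det M')%:~R / (2 * alpha) in
   forall q0 : int,
     simultaneous_approx r alpha x q0 \/
     good_diophantine_approx r (alpha / root_dim r n.+2) x N q0 ->
   exists2 qv : 'cV[int]_n.+2,
     map_mx intr qv = map_mx intr M' *m cfracv (q0%:~R *: x)
     & short_vector r alpha (map_mx intr M) qv).
Proof.
move=> alpha; have a0 := leq_trans hb hab.
have MX := max_entry_bound hmax; have X0 := max_entry_gt0 hdet MX.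
pose X := `|M ord_max 0%R|%N.
have XE : M ord_max 0 = X%:Z by rewrite gtz0_abs.
have Xn0 : (0 < X)%N by rewrite -ltz_nat -XE.
rewrite XE in MX; split; first exact: (run_exists R hdet a0 Xn0 XE).
move=> p e c j M' b1 b2 [[[pp pXD] pmin] erun redc jE M'E [bez _] dM'] x N q0 approx.
have p0 := prime_gt0 pp; have p1 := prime_gt1 pp.
have c00 : detC_adj (loop_mx M p e n.+1) != 0.
  by have [[_]] := erun n (leqnn n); rewrite topleft_full.
have [c1 _ _] := reduced_cP pp c00 redc.
rewrite (size_boundE R a XE) -abszE in jE.
have [_ Sc] := ceil_log_bound (size_bound_gt1 n a0 Xn0) c1 jE.
have eb k : (k <= n)%N -> (e k <= k.*2.+2)%N by case/(loop_run_bound p1 erun).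
pose P : 'M[int]_n.+2 := \matrix_(i < n.+2, k < n.+2) perturbation int p e n.+1 i k.
have MM' : M *m M' = (c ^+ j * \det M)%:M + M *m P.
  have -> : M' = c ^+ j *: \adj M + P.
    by apply/matrixP => i k; rewrite M'E (eval_loop_mx M p e (c ^+ j)) !mxE.
  by rewrite mulmxDr -scalemxAr mul_mx_adj scale_scalar_mx.
have D0 : (0 < `|\det M|)%N by rewrite absz_gt0.
have PXD : (primorial p <= X * `|\det M|)%N.
  apply: dvdn_leq; first by rewrite muln_gt0 Xn0.
  apply: primorial_dvd => q qq qp; apply: contraT => nd.
  suff : (p <= q)%N by rewrite leqNgt qp.
  by apply: pmin; split=> //; rewrite dvdzE abszM XE.
apply: (@reduction_correct R r n hr a b X (X * (n.+2 * p + p ^ n.*2.+2))%N M M'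
  (M *m P) (c ^+ j * \det M) b1 b2 hb hab Xn0 _ hdet dM' MX _ MM' bez _ q0 approx).
- by rewrite muln_gt0 Xn0 addn_gt0 muln_gt0 p0.
- by move=> i k; apply: error_entry_bound.
- by rewrite abszM abszX; apply: (parameter_bound R).
Qed.
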